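(* Let $A\subset\mathbb R^n$ be such that $c_*(A)>0$ and $\mathcal E^+(A)$ is strongly closed, and let $\omega$ be a (signed) measure such that either (i) $\omega\in\mathcal E$, or (ii) $\omega^+$ is bounded, $U^\omega$ is upper semicontinuous on $\overline{A}$, and $\sup_{x\in A}U^{|\omega|}(x)<\infty$. Put $f:=-U^\omega$. If the inner pseudo-balayage $\hat\omega^A$ of $\omega$ onto $A$ satisfies $\hat{\omega}^A(\mathbb R^n)=1$, then there exists a (unique) $\lambda_{A,f}$ minimizing $I_f(\mu)$ over $\mu\in\breve{\mathcal E}^+(A)$. Furthermore, then $$\lambda_{A,f}=\hat{\omega}^A,\quad w_f(A)=\hat{w}_f(A),\quad c_{A,f}=0.$$
   Context: Let $n\geqslant2$, $0<\alpha<n$, and $\kappa_\alpha(x,y):=|x-y|^{\alpha-n}$ on $\mathbb R^n$. A measure is a real-valued (signed) Radon measure $\mu$ on $\mathbb R^n$ with Hahn--Jordan decomposition $\mu=\mu^+-\mu^-$ and $|\mu|:=\mu^++\mu^-$; $\mu$ is bounded if $|\mu|(\mathbb R^n)<\infty$. All measures considered are assumed to satisfy $\int_{|y|>1}|y|^{\alpha-n}\,d|\mu|(y)<\infty$. Potential: $U^\mu(x):=\int\kappa_\alpha(x,y)\,d\mu(y)$. Energy: $I(\mu):=\int\kappa_\alpha\,d(\mu\otimes\mu)$. $\mathcal E$ is the pre-Hilbert space of all measures of finite energy, with inner product $\langle\mu,\nu\rangle=\int\kappa_\alpha\,d(\mu\otimes\nu)$ and norm $\|\mu\|=\sqrt{I(\mu)}$;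 the norm topology is called strong. $\mathcal E^+$ is the cone of positive measures in $\mathcal E$. For $A\subset\mathbb R^n$ (not necessarily Borel), $\mathcal E^+(A)$ is the set of $\mu\in\mathcal E^+$ concentrated on $A$ (i.e. $\mathbb R^n\setminus A$ is $\mu$-negligible), and $\overline A$ is the closure of $A$ in $\mathbb R^n$. Inner capacity: $c_*(A):=\sup\{c(K):K\subset A\text{ compact}\}$, where $c(K):=1/\inf\{\|\mu\|^2:\mu\in\mathcal E^+(K),\ \mu(K)=1\}$ (with $\inf\varnothing=\infty$, $1/\infty=0$). For $f:=-U^\omega$: $\mathcal E^+_f(A)$ is the set of $\mu\in\mathcal E^+(A)$ for which $f$ is $\mu$-integrable; $I_f(\mu):=\|\mu\|^2+2\int f\,d\mu=\|\mu\|^2-2\int U^\omega\,d\mu$; $\hat w_f(A):=\inf_{\mu\in\mathcal E^+_f(A)}I_f(\mu)$. The inner pseudo-balayage $\hat\omega^A$ is the measure in $\mathcal E^+_f(A)$ with $I_f(\hat\omega^A)=\hat w_f(A)$; under the stated assumptions it exists and is unique. Further, $\breve{\mathcal E}^+(A):=\{\mu\in\mathcal E^+(A):\mu(\mathbb R^n)=1\}$ and $w_f(A):=\inf_{\mu\in\breve{\mathcal E}^+(A)}I_f(\mu)$; under the stated assumptions $\breve{\mathcal E}^+(A)\subset\mathcal E^+_f(A)$. When a minimizer $\lambda_{A,f}$ exists, $U_f^{\lambda_{A,f}}:=U^{\lambda_{A,f}}+f$ and the inner $f$-weighted equilibrium constant is $c_{A,f}:=\int U_f^{\lambda_{A,f}}\,d\lambda_{A,f}=w_f(A)-\int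 f\,d\lambda_{A,f}$. *)

(* Defs.v *)
From HB Require Import structures.
From mathcomp Require Import all_boot all_order all_algebra.
From mathcomp Require Import all_classical all_reals all_analysis.

Set Implicit Arguments.
Unset Strict Implicit.
Unset Printing Implicit Defensive.
Import Order.TTheory GRing.Theory Num.Theory.
Import numFieldNormedType.Exports.

Local Open Scope classical_set_scope.
Local Open Scope ring_scope.
Local Open Scope ereal_scope.

(* R^n is ['rV[R]_n]; its topology is the usual one (the
   library metric is the sup-metric), and it carries the Borel sigma-algebra. *)
HB.instance Definition _ (R : realType) (n : nat) :=
  Measurable.copy 'rV[R]_n (g_sigma_algebraType (@open 'rV[R]_n)).

Definition euclid_norm (R : realType) (n : nat) (x : 'rV[R]_n) : R :=
  Num.sqrt (\sum_(i < n) (x ord0 i) ^+ 2)%R.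

(* |x - y|^(alpha - n); as alpha < n, the value on the diagonal is +oo
   (whereas [powR] would give 0 there). *)
Definition riesz (R : realType) (n : nat) (alpha : R) (x y : 'rV[R]_n) : \bar R :=
  if x == y then +oo else (euclid_norm (x - y) `^ (alpha - n%:R))%:E.

(* Real-valued signed Radon measures, given by their Hahn-Jordan decomposition:
   two mutually singular positive Borel measures, finite on compact sets (on R^n
   regularity is then automatic).  Neither part need be finite, which is why the
   library's charges do not apply.  [sm_tail] is the standing assumption
   int_{|y|>1} |y|^(alpha-n) d|mu|(y) < oo. *)
Record signed_measure (R : realType) (n : nat) (alpha : R) := SignedMeasure {
  sm_pos : {measure set 'rV[R]_n -> \bar R} ;
  sm_neg : {measure set 'rV[R]_n -> \bar R} ;
  sm_posK : forall K : set 'rV[R]_n, compact K -> sm_pos K < +oo ;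
  sm_negK : forall K : set 'rV[R]_n, compact K -> sm_neg K < +oo ;
  sm_sing : exists P : set 'rV[R]_n,
    [/\ measurable P, sm_pos (~` P) = 0 & sm_neg P = 0] ;
  sm_tail : \int[measure_add sm_pos sm_neg]_(y in [set y | (1 < euclid_norm y)%R])
              (euclid_norm y `^ (alpha - n%:R))%:E < +oo
}.

Section Definitions.
Context (R : realType) (n : nat) (alpha : R).
Local Notation Rn := 'rV[R]_n.
Local Notation smeasure := (signed_measure n alpha).
Implicit Types (mu nu sigma omega : smeasure) (A D K : set Rn) (f g : Rn -> \bar R).

Definition sm_abs mu : {measure set Rn -> \bar R} :=
  measure_add (sm_pos mu) (sm_neg mu).

(* Measures are equal when they agree on Borel sets: the library's [measure]
   type leaves the values on non-measurable sets unspecified. *)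
Definition sm_eq mu nu : Prop :=
  forall B : set Rn, measurable B ->
    sm_pos mu B = sm_pos nu B /\ sm_neg mu B = sm_neg nu B.

(* sigma = mu - nu, with the negative parts moved across so that only sums of
   positive measures occur. *)
Definition is_difference sigma mu nu : Prop :=
  forall B : set Rn, measurable B ->
    sm_pos sigma B + sm_neg mu B + sm_pos nu B =
    sm_neg sigma B + sm_pos mu B + sm_neg nu B.

Definition sm_positive mu : Prop :=
  forall B : set Rn, measurable B -> sm_neg mu B = 0.

Definition mass mu : \bar R := sm_pos mu setT - sm_neg mu setT.

(* In the next definitions the library convention +oo - oo = -oo only matters
   where the mathematical value is undefined; the result is then infinite. *)
Definition sm_integral mu g : \bar R :=
  \int[sm_pos mu]_x g x - \int[sm_neg mu]_x g x.

Definition potential mu (x : Rn) : \bar R :=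
  sm_integral mu (fun y => riesz alpha x y).

(* int kappa d(mu (x) nu): the positive part of mu (x) nu is
   mu+ (x) nu+ + mu- (x) nu-, the negative part mu+ (x) nu- + mu- (x) nu+. *)
Definition inner_product mu nu : \bar R :=
  let kappa := fun z : Rn * Rn => riesz alpha z.1 z.2 in
  (\int[sm_pos mu \x sm_pos nu]_z kappa z + \int[sm_neg mu \x sm_neg nu]_z kappa z) -
  (\int[sm_pos mu \x sm_neg nu]_z kappa z + \int[sm_neg mu \x sm_pos nu]_z kappa z).

Definition energy mu : \bar R := inner_product mu mu.

Definition finite_energy : set smeasure := [set mu | energy mu \is a fin_num].

Definition energy_norm mu : \bar R := sqrte (energy mu).

(* E^+(A); A need not be Borel. *)
Definition Eplus A : set smeasure :=
  [set mu | [/\ finite_energy mu, sm_positive mu &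
               (sm_abs mu).-negligible (~` A)]].

(* F is closed in the pre-Hilbert space E of (signed) measures of finite energy. *)
Definition strongly_closed (F : set smeasure) : Prop :=
  forall nu, finite_energy nu ->
    (forall e : R, (0 < e)%R -> exists mu sigma,
       [/\ F mu, is_difference sigma mu nu, finite_energy sigma &
           energy_norm sigma < e%:E]) ->
    F nu.

(* Empty infimum is +oo, and (+oo)^-1 = 0. *)
Definition capacity K : \bar R :=
  (ereal_inf [set energy_norm mu ^+ 2 |
               mu in [set mu | Eplus K mu /\ mass mu = 1]])^-1.

Definition inner_capacity A : \bar R :=
  ereal_sup [set capacity K | K in [set K | compact K /\ K `<=` A]].

(* Upper semicontinuity of the restriction of g to D. *)
Definition usc_on D g : Prop :=
  forall x, D x -> forall a : R, g x < a%:E ->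
    \forall y \near within D (nbhs x), g y < a%:E.

Definition external_field omega (x : Rn) : \bar R := - potential omega x.

Definition Eplus_f f A : set smeasure :=
  [set mu | Eplus A mu /\ (sm_abs mu).-integrable setT f].

Definition I_f f mu : \bar R := energy_norm mu ^+ 2 + 2%:E * sm_integral mu f.

Definition w_hat_f f A : \bar R := ereal_inf [set I_f f mu | mu in Eplus_f f A].

Definition is_inner_pseudo_balayage omega A (omega_hat : smeasure) : Prop :=
  let f := external_field omega in
  Eplus_f f A omega_hat /\ I_f f omega_hat = w_hat_f f A.

Definition Eplus1 A : set smeasure := [set mu | Eplus A mu /\ mass mu = 1].

Definition w_f f A : \bar R := ereal_inf [set I_f f mu | mu in Eplus1 A].

Definition is_minimizer f A (lambda : smeasure) : Prop :=
  Eplus1 A lambda /\ I_f f lambda = w_f f A.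

(* c_{A,f}, for lambda = lambda_{A,f} *)
Definition equilibrium_constant f (lambda : smeasure) : \bar R :=
  sm_integral lambda (fun x => potential lambda x + f x).

End Definitions.

Arguments Eplus {R n} alpha A.
Arguments Eplus1 {R n} alpha A.
Arguments w_hat_f {R n} alpha f A.
Arguments w_f {R n} alpha f A.
Arguments inner_capacity {R n} alpha A.

(* Main.v *)
Require Import Defs.
From HB Require Import structures.
From mathcomp Require Import all_boot all_order all_algebra.
From mathcomp Require Import all_classical all_reals all_analysis.
From mathcomp Require Import measurable_realfun.
From mathcomp Require Import ring lra.
Import Order.TTheory GRing.Theory Num.Theory.
Import numFieldNormedType.Exports.
Set Implicit Arguments.
Unset Strict Implicit.
Unset Printing Implicit Defensive.
Local Open Scope classical_set_scope.
Local Open Scope ring_scope.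

(** Existence costs little.  The pseudo-balayage minimizes [I_f] over the cone
    of all measures of E+(A) against which [f] is integrable, it has mass one,
    and every measure of E+(A) of mass one lies in that cone; so it minimizes
    over the measures of mass one as well, and both infima agree.  The inclusion
    is clear when U^|omega| is bounded on A.  When omega has finite energy it
    says that <mu, omega+> and <mu, omega-> are finite ([mutual_lty]), which
    follows from 2<mu, nu> <= ||mu||^2 + ||nu||^2.  The equilibrium constant
    is half the derivative at s = 1 of I_f(s lambda) = s^2 ||lambda||^2 +
    2s int f dlambda; as s lambda stays in the cone for s >= 0, it vanishes
    ([critical_at_one]).  If lambda' is another minimizer, then comparing with
    (lambda + lambda')/2 gives ||lambda - lambda'||^2 <= 0, and it remains to
    know that the Riesz kernel is strictly positive definite on differences of
    positive measures of mass one and finite energy ([energy_principle]).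

    The Riesz kernel is a mixture of Gaussians: with p = 2/(n - alpha) and
    C = int_R exp(-|v|^p) dv, scaling the Lebesgue measure of the line gives
    C |x - y|^(alpha - n) = int_R exp(-|v|^p |x - y|^2) dv ([gauss_mix_riesz]).
    So everything reduces to the kernels exp(-t |x - y|^2), which are bounded,
    as follows.
    - They are positive semidefinite, because exp(2t x.y) is a power series
      with nonnegative coefficients in x.y ([psd_gauss]).  Integrating over v
      gives the inequality between energies.
    - If ||lambda - lambda'|| = 0, then the Gaussian energies of
      sigma = lambda - lambda' vanish for almost all v, and by continuity for
      all t > 0 ([energy_eq_signed_int2_eq0]).  Adding a multiple c of the Dirac
      mass at z to sigma changes the energy to 2cu + c^2, where u is the Gaussian
      transform of sigma at z.  This is nonnegative for all c, so u = 0
      ([signed_int_gauss_eq0]).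
    - A difference of finite measures with vanishing Gaussian transforms is
      zero ([gauss_determines]): a product of two Gaussians is a multiple of a
      Gaussian, so that the bounded functions which annihilate sigma when
      multiplied by any Gaussian are stable under multiplication by Gaussians,
      and, taking limits, by indicators of balls and of all Borel sets.

    Only the Lebesgue measure of the line is used in this route, and no Fourier
    transform. *)

(** * Bounded functions and integrals against a difference of measures *)

Lemma normr_series_exp_coeff_le (R : realType) (x M : R) k :
  `|x| <= M -> `|series (exp_coeff x) k| <= expR M.
Proof.
move=> xM; apply: (@le_trans _ _ (series (exp_coeff M) k)).
  rewrite (le_trans (ler_norm_sum _ _ _))//; apply: ler_sum => i _.
  rewrite /exp_coeff/= normrM normrX ler_pM//.
    by rewrite lerXn2r// nnegrE// (le_trans _ xM).
  by rewrite ger0_norm.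
have M0 : 0 <= M by rewrite (le_trans _ xM).
apply: nondecreasing_cvgn_le; last exact: is_cvg_series_exp_coeff.
apply: nondecreasing_series => i _ _; exact: exp_coeff_ge0.
Qed.

Section bounded_measurable.
Context d (T : measurableType d) (R : realType).
Implicit Types h : T -> R.

Definition bmf h := measurable_fun setT h /\ exists M : R, forall x, `|h x| <= M.

Lemma bmf_cst (r : R) : bmf (fun=> r).
Proof. by split; [exact: measurable_cst|exists `|r|]. Qed.

Lemma bmfD h g : bmf h -> bmf g -> bmf (fun x => h x + g x).
Proof.
move=> [mh [M hM]] [mg [N gN]]; split; first exact: measurable_funD.
by exists (M + N) => x; rewrite (le_trans (ler_normD _ _))// lerD.
Qed.

Lemma bmfM h g : bmf h -> bmf g -> bmf (fun x => h x * g x).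
Proof.
move=> [mh [M hM]] [mg [N gN]]; split; first exact: measurable_funM.
by exists (M * N) => x; rewrite normrM ler_pM.
Qed.

Lemma bmf_integrable (m : {finite_measure set T -> \bar R}) h :
  bmf h -> m.-integrable setT (EFin \o h).
Proof.
move=> [mh [M hM]]; apply: measurable_bounded_integrable => //.
  by rewrite ltey_eq fin_num_measure.
exists `|M|; split; first by rewrite num_real.
by move=> x Mx y _ /=; rewrite (le_trans (hM _))// (le_trans (ler_norm _))// ltW.
Qed.

End bounded_measurable.

Section signed_integral.
Context d (T : measurableType d) (R : realType).
Variables (l l' : {finite_measure set T -> \bar R}) (c : R) (z : T).
Implicit Types h : T -> R.

(** The integral against the signed measure l - l' + c delta_z.  The atom at z
    serves for the Cauchy-Schwarz inequality against a Dirac mass: c can be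
    varied over the whole line, which a positive measure would not allow. *)
Definition signed_int h := \int[l]_x h x - \int[l']_x h x + c * h z.

Lemma signed_intD h g : bmf h -> bmf g ->
  signed_int (fun x => h x + g x) = signed_int h + signed_int g.
Proof.
by move=> bh bg; rewrite /signed_int !RintegralD ?(bmf_integrable _)//; ring.
Qed.

Lemma signed_intZ r h : bmf h -> signed_int (fun x => r * h x) = r * signed_int h.
Proof.
by move=> bh; rewrite /signed_int !RintegralZl ?(bmf_integrable _)//; ring.
Qed.

Lemma cvg_Rintegral (m : {finite_measure set T -> \bar R})
    (h_ : nat -> T -> R) h (M : R) :
  (forall n, measurable_fun setT (h_ n)) -> (forall n x, `|h_ n x| <= M) ->
  (forall x, h_ n x @[n --> \oo] --> h x) ->
  \int[m]_x h_ n x @[n --> \oo] --> \int[m]_x h x.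
Proof.
move=> mh hM hh.
have mlim : measurable_fun setT h by apply: (measurable_fun_cvg mh) => x _; exact: hh.
have [ih _] : [/\ m.-integrable setT (EFin \o h), 
  [sequence \int[m]_x `|(h_ n x)%:E - (h x)%:E|%E]_n @ \oo --> 0%E &
  [sequence \int[m]_x (h_ n x)%:E]_n @ \oo --> \int[m]_x (h x)%:E]%E.
  apply: (@dominated_convergence _ _ _ m setT measurableT
    (fun n x => (h_ n x)%:E) (EFin \o h) (fun=> M%:E)).
  - by move=> n; exact/measurable_EFinP.
  - exact/measurable_EFinP.
  - by apply/aeW => x _; apply/cvg_EFin; [exact: nearW|exact/hh].
  - by have := bmf_integrable m (bmf_cst T M).
  - by apply/aeW => x n _; rewrite lee_fin.
rewrite -[X in _ --> X](fineK (integrable_fin_num _ ih))// => /fine_cvgP[_]; exact.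
Qed.


Lemma signed_int_cvg (h_ : nat -> T -> R) h (M : R) :
  (forall n, measurable_fun setT (h_ n)) -> (forall n x, `|h_ n x| <= M) ->
  (forall x, h_ n x @[n --> \oo] --> h x) ->
  signed_int (h_ n) @[n --> \oo] --> signed_int h.
Proof.
move=> mh hM hh; apply: cvgD; last by apply: cvgMl_tmp; exact: hh.
by apply: cvgB; exact: (cvg_Rintegral mh hM hh).
Qed.

Lemma normr_Rintegral_le (m : {finite_measure set T -> \bar R}) h (M : R) :
  measurable_fun setT h -> (forall x, `|h x| <= M) ->
  `|\int[m]_x h x| <= M * fine (m setT).
Proof.
move=> mh hM; have bh : bmf h by split=> //; exists M.
apply: (le_trans (le_normr_Rintegral _ (bmf_integrable m bh))) => //.
rewrite -Rintegral_cst//; apply: le_Rintegral => //.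
- exact/integrable_norm/bmf_integrable.
- exact/bmf_integrable/bmf_cst.
Qed.

(** Iterated integrals of bounded kernels make sense: the partial integral is
    measurable by Fubini's theorem and bounded because the measure is finite. *)
Lemma bmf_Rintegral (m : {finite_measure set T -> \bar R}) (F : T * T -> R) :
  bmf F -> bmf (fun x => \int[m]_y F (x, y)).
Proof.
move=> [mF [M FM]]; split; last first.
  exists (M * fine (m setT)) => x; apply: normr_Rintegral_le => //.
  exact: measurableT_comp.
apply: (measurableT_comp (@fine_measurable R setT measurableT)).
apply: (@measurable_fubini_F _ _ _ _ _ m m (EFin \o F)).
apply: measurable_bounded_integrable => //.
- rewrite -setXTT [X in (X < _)%E](_ : _ = m setT * m setT)%E; last first.
    exact: product_measure1E.
  by rewrite lte_mul_pinfty// ?fin_num_measure// ltey_eq fin_num_measure.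
- exists `|M|; split => // x Mx y _ /=.
  by rewrite (le_trans (FM _))// (le_trans (ler_norm _))// ltW.
Qed.

Lemma bmf_signed_int (F : T * T -> R) : bmf F -> bmf (fun x => signed_int (fun y => F (x, y))).
Proof.
move=> bF; have bmfN h : bmf h -> bmf (fun x => - h x).
  move=> bh; have := bmfM (bmf_cst _ (-1)) bh.
  by under eq_fun do rewrite mulN1r.
apply: bmfD; first by apply: bmfD; [|apply: bmfN]; exact: bmf_Rintegral.
apply: bmfM; first exact: bmf_cst.
case: bF => mF [M FM]; split; last by exists M.
exact: measurable_fun_pair1.
Qed.

End signed_integral.

(** * Positive semidefinite kernels *)

Section signed_integral2.
Context d (T : measurableType d) (R : realType).
Variables (l l' : {finite_measure set T -> \bar R}) (c : R) (z : T).
Local Notation E := (signed_int l l' c z).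

Definition signed_int2 (F : T * T -> R) := E (fun x => E (fun y => F (x, y))).

Lemma bmf_pair1 (F : T * T -> R) x : bmf F -> bmf (fun y => F (x, y)).
Proof.
move=> [mF [M FM]]; split; last by exists M.
exact: measurableT_comp.
Qed.

Lemma signed_int2D F G : bmf F -> bmf G ->
  signed_int2 (fun p => F p + G p) = signed_int2 F + signed_int2 G.
Proof.
move=> bF bG; rewrite /signed_int2 -signed_intD; try exact: bmf_signed_int.
congr signed_int; apply/funext => x; rewrite signed_intD//; exact: bmf_pair1.
Qed.

Lemma signed_int2Z r F : bmf F -> signed_int2 (fun p => r * F p) = r * signed_int2 F.
Proof.
move=> bF; rewrite /signed_int2 -signed_intZ; last exact: bmf_signed_int.
congr signed_int; apply/funext => x; rewrite signed_intZ//; exact: bmf_pair1.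
Qed.

Lemma signed_int2_tensor h : bmf h -> signed_int2 (fun p => h p.1 * h p.2) = E h ^+ 2.
Proof.
move=> bh; rewrite /signed_int2/= expr2 -signed_intZ//.
by congr signed_int; apply/funext => x; rewrite signed_intZ// mulrC.
Qed.

Lemma signed_int_bound (h : T -> R) (M : R) :
  measurable_fun setT h -> (forall x, `|h x| <= M) ->
  `|E h| <= M * (fine (l setT) + fine (l' setT) + `|c|).
Proof.
move=> mh hM; rewrite /signed_int (le_trans (ler_normD _ _))// mulrDr lerD//.
  by rewrite (le_trans (ler_normB _ _))// mulrDr lerD// normr_Rintegral_le.
by rewrite normrM mulrC ler_wpM2r.
Qed.

Lemma signed_int2_cvg (F_ : nat -> T * T -> R) F (M : R) :
  (forall n, measurable_fun setT (F_ n)) -> (forall n x, `|F_ n x| <= M) ->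
  (forall x, F_ n x @[n --> \oo] --> F x) ->
  signed_int2 (F_ n) @[n --> \oo] --> signed_int2 F.
Proof.
move=> mF FM FF.
apply: (@signed_int_cvg _ _ _ _ _ _ _ _ _ (M * (fine (l setT) + fine (l' setT) + `|c|))).
- by move=> n; apply: (bmf_signed_int _ _ _ _ _).1; split => //; exists M.
- by move=> n x; apply: signed_int_bound => //; exact: measurableT_comp.
- by move=> x; apply: (@signed_int_cvg _ _ _ _ _ _ _ _ _ M) => // n; exact: measurableT_comp.
Qed.

(** Testing the kernel against all densities h, and not only h = 1, is what
    makes the class stable under multiplication by h(x)h(y).  The measure
    l - l' + c delta_z is kept fixed, so that no density with respect to a
    signed measure is ever taken. *)
Definition psd (F : T * T -> R) := bmf F /\
  forall h : T -> R, bmf h -> 0 <= signed_int2 (fun p => h p.1 * h p.2 * F p).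

Lemma bmf_tensor (h : T -> R) : bmf h -> bmf (fun p : T * T => h p.1 * h p.2).
Proof.
move=> [mh [M hM]]; apply: bmfM.
  by split; [exact: measurableT_comp|exists M => x].
by split; [exact: measurableT_comp|exists M => x].
Qed.

Lemma psd1 : psd (fun=> 1).
Proof.
split=> [|h bh]; first exact: bmf_cst.
by under eq_fun do rewrite mulr1; rewrite signed_int2_tensor// sqr_ge0.
Qed.

Lemma psdD F G : psd F -> psd G -> psd (fun p => F p + G p).
Proof.
move=> [bF pF] [bG pG]; split=> [|h bh]; first exact: bmfD.
under eq_fun do rewrite mulrDr.
have bh2 := bmf_tensor bh.
by rewrite signed_int2D; [apply: addr_ge0; [exact: pF|exact: pG]|exact: bmfM|exact: bmfM].
Qed.

Lemma psdZ r F : 0 <= r -> psd F -> psd (fun p => r * F p).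
Proof.
move=> r0 [bF pF]; split=> [|h bh]; first by apply: bmfM => //; exact: bmf_cst.
under eq_fun do rewrite mulrCA.
have bh2 := bmf_tensor bh.
by rewrite signed_int2Z; [apply: mulr_ge0 => //; exact: pF|exact: bmfM].
Qed.

(** The factor h(x)h(y) is absorbed into the density of the test. *)
Lemma psd_tensor h F : bmf h -> psd F -> psd (fun p => h p.1 * h p.2 * F p).
Proof.
move=> bh [bF pF]; split=> [|g bg].
  by apply: bmfM => //; exact: bmf_tensor.
have := pF _ (bmfM bg bh); congr (_ <= _); congr signed_int2.
by apply/funext => p; ring.
Qed.

Lemma psd_cvg (F_ : nat -> T * T -> R) F (M : R) :
  (forall n, psd (F_ n)) -> (forall n x, `|F_ n x| <= M) ->
  (forall x, F_ n x @[n --> \oo] --> F x) -> psd F.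
Proof.
move=> pF FM FF; split=> [|h bh].
  split; first by apply: (measurable_fun_cvg (fun n => (pF n).1.1)) => x _; exact: FF.
  exists M => x; have /cvg_norm FFx := FF x.
  apply: (cvgr_to_le FFx); exact: nearW.
have [mh2 [N hN]] := bmf_tensor bh.
have : signed_int2 (fun p => h p.1 * h p.2 * F_ n p) @[n --> \oo] -->
    signed_int2 (fun p => h p.1 * h p.2 * F p).
  apply: (@signed_int2_cvg _ _ (N * M)).
  - by move=> n; apply: measurable_funM => //; exact: (pF n).1.1.
  - by move=> n x; rewrite normrM ler_pM.
  - by move=> x; apply: cvgMl_tmp; exact: FF.
move=> hF; apply: (cvgr_to_ge hF); apply: nearW => n.
exact: (pF n).2.
Qed.

Lemma psd_sum_tensor (n : nat) (g : 'I_n -> T -> R) F :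
  (forall i, bmf (g i)) -> psd F ->
  psd (fun p => (\sum_(i < n) g i p.1 * g i p.2) * F p).
Proof.
elim: n g => [|n ih] g bg pF.
  by under eq_fun do rewrite big_ord0; exact: psdZ.
under eq_fun do rewrite big_ord_recr mulrDl.
apply: psdD; last exact: psd_tensor.
exact: (ih (fun i => g (widen_ord (leqnSn n) i))).
Qed.

(** The exponential series has nonnegative coefficients, and each power of the
    sum of tensors g_i(x)g_i(y) is again handled by [psd_sum_tensor]; this is
    Schur's product theorem for the kernels at hand. *)
Lemma psd_exp (n : nat) (g : 'I_n -> T -> R) r F :
  0 <= r -> (forall i, bmf (g i)) -> psd F ->
  psd (fun p => expR (r * \sum_(i < n) g i p.1 * g i p.2) * F p).
Proof.
move=> r0 bg pF.
pose s p := r * \sum_(i < n) g i p.1 * g i p.2.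
have psds k : psd (fun p => s p ^+ k * F p).
  elim: k => [|k ih]; first by under eq_fun do rewrite expr0 mul1r.
  under eq_fun do rewrite exprS -mulrA /s -mulrA.
  exact/psdZ/psd_sum_tensor.
have bs : bmf s.
  apply: bmfM; first exact: bmf_cst.
  have := (psd_sum_tensor bg psd1).1.
  by under eq_fun do rewrite mulr1.
have [ms [M sM]] := bs.
have [mF [N FN]] := pF.1.
pose Fk k p := series (exp_coeff (s p)) k * F p.
apply: (@psd_cvg Fk _ (expR M * N)).
- elim=> [|k ih].
    by rewrite /Fk /series/=; under eq_fun do rewrite big_geq//; exact: psdZ.
  rewrite /Fk; under eq_fun do rewrite seriesSr mulrDl.
  apply: psdD; first exact: ih.
  rewrite /exp_coeff/=; under eq_fun do rewrite mulrAC mulrC.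
  by apply: psdZ.
- by move=> k x; rewrite /Fk normrM ler_pM// normr_series_exp_coeff_le.
- by move=> x; apply: cvgMr_tmp; exact: is_cvg_series_exp_coeff.
Qed.

End signed_integral2.

(** * Scaling integrals of Gaussians over the line *)

Section riesz_mixture.
Context (R : realType).
Local Notation leb := (@lebesgue_measure R).
Local Open Scope ereal_scope.

(** The image of the Lebesgue measure under v |-> kv, rescaled by k, gives
    intervals their length, hence is the Lebesgue measure. *)
Lemma ge0_integral_scale (k : R) (f : R -> \bar R) : (0 < k)%R ->
  measurable_fun setT f -> (forall x, 0 <= f x) ->
  \int[leb]_v f v = k%:E * \int[leb]_v f (k * v)%R.
Proof.
move=> k0 mf f0.
pose K : {nonneg R} := NngNum (ltW k0).
pose phi : measurableTypeR R -> measurableTypeR R := *%R k.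
have mphi : measurable_fun setT phi by exact: mulrl_measurable.
pose nu0 : {measure set (measurableTypeR R) -> \bar R} :=
  measure_function_pushforward__canonical__measure_function_Measure leb mphi.
rewrite (eq_measure_integral (mscale K nu0)); last first.
  move=> A mA _; apply: lebesgue_measure_unique => //= _ [[a b]] _ <-.
  rewrite /mscale/= /pushforward.
  have -> : phi @^-1` `]a, b]%classic = `](a / k)%R, (b / k)%R]%classic.
    by apply/seteqP; split => x /=; rewrite !in_itv/= ltr_pdivrMr// ler_pdivlMr//;
      rewrite /phi mulrC.
  rewrite !lebesgue_measure_itv/= !lte_fin ltr_pM2r ?invr_gt0//.
  case: ifPn => _; last by rewrite mule0.
  by rewrite -!EFinD -EFinM -mulrBl mulrCA divff ?mulr1// gt_eqF.
rewrite ge0_integral_mscale// ge0_integral_pushforward//.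
Qed.

Lemma continuous_inv1Dx2 : continuous (fun x : R => (1 + x ^+ 2)^-1)%R.
Proof.
move=> x; apply: (@continuousV R R (fun x : R => 1 + x ^+ 2)%R).
  by rewrite gt_eqF// ltr_pwDl// sqr_ge0.
by apply: cvgD; [exact: cvg_cst|exact: exprn_continuous].
Qed.

Lemma measurable_inv1Dx2 : measurable_fun setT (fun x : R => (1 + x ^+ 2)^-1)%R.
Proof. by apply: continuous_measurable_fun; exact: continuous_inv1Dx2. Qed.

(** The primitive is the arctangent. *)
Lemma integral_inv1Dx2_lty : \int[leb]_x ((1 + x ^+ 2)^-1)%:E < +oo.
Proof.
have d0 x : (0 < 1 + x ^+ 2 :> R)%R by rewrite ltr_pwDl// sqr_ge0.
rewrite ge0_symfun_integralT; last 3 first.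
- by move=> x; rewrite invr_ge0 ltW.
- exact: continuous_inv1Dx2.
- by move=> x /=; rewrite sqrrN.
rewrite -set_itvcy (@ge0_continuous_FTC2y _ _ atan _ (pi / 2))//.
- by rewrite -EFinB -EFinM ltry.
- by move=> x _; rewrite invr_ge0 ltW.
- exact/continuous_subspaceT/continuous_inv1Dx2.
- exact: cvgy_atan.
- exact: (cvg_at_right_filter (@continuous_atan R 0%R)).
- by move=> x _; rewrite derive1_atan.
Qed.

Variables (p : R) (p0 : (0 < p)%R).

(** The parameter t of the Gaussian exp(-ta) is parametrized as |v|^p because
    then the mixing measure is the Lebesgue measure itself, and a linear change
    of variable computes the dependence on a. *)
Definition gauss_mix (a : R) := \int[leb]_v (expR (- (`|v| `^ p * a)))%:E.

Lemma measurable_gauss_mix a :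
  measurable_fun setT (fun v : R => (expR (- (`|v| `^ p * a)))%:E).
Proof.
apply/measurable_EFinP; apply: (measurableT_comp (@measurable_expR R)).
apply: measurable_funN.
apply: measurable_funM => //.
by apply: (measurableT_comp (measurable_powR p)); exact: normr_measurable.
Qed.

Lemma gauss_mix_ge0 a : 0 <= gauss_mix a.
Proof. by apply: integral_ge0 => x _; rewrite lee_fin expR_ge0. Qed.

Lemma gauss_mix0 : gauss_mix 0 = +oo.
Proof.
rewrite /gauss_mix; under eq_integral do rewrite mulr0 oppr0 expR0.
by rewrite integral_cst//= -set_itvNyy lebesgue_measure_itv/= mul1e.
Qed.

(** Substitute v |-> a^(-1/p) v. *)
Lemma gauss_mix_scale a : (0 < a)%R -> gauss_mix a = (a `^ (- p^-1))%:E * gauss_mix 1.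
Proof.
move=> a0; have k0 : (0 < a `^ (- p^-1))%R by exact: powR_gt0.
rewrite {1}/gauss_mix (ge0_integral_scale k0); last 2 first.
- exact: measurable_gauss_mix.
- by move=> x; rewrite lee_fin expR_ge0.
congr (_ * _); apply: eq_integral => v _.
congr (expR (- _))%:E.
rewrite normrM (ger0_norm (ltW k0)) powRM ?powR_ge0// -powRrM.
rewrite mulNr mulVf ?gt_eqF// powR_inv1 ?ltW//.
by rewrite mulr1 mulrAC mulVf ?mul1r// gt_eqF.
Qed.

(** The exponential series dominates each of its terms, so exp(-|v|^p) is at
    most a constant times |v|^(-p(n+1)); choosing p(n+1) >= 2 compares it with
    1/(1 + v^2). *)
Lemma gauss_mix1_lty : gauss_mix 1 < +oo.
Proof.
(* n + 1 >= 2/p, so that v^2 <= (v^p)^(n+1) for v >= 1 *)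
have [n pn] : exists n : nat, (2 <= p * n.+1%:R)%R.
  exists (Num.trunc (2 / p)); rewrite -ler_pdivrMl// mulrC ltW//.
  by have /andP[_] := truncn_itv (divr_ge0 (ler0n R 2) (ltW p0)).
pose C : R := (2 * (n.+1)`!%:R)%R.
have bnd (v : R) : (0 <= v)%R -> (expR (- (v `^ p * 1)) <= C * (1 + v ^+ 2)^-1)%R.
  move=> v0; rewrite mulr1 ler_pdivlMr; last by rewrite ltr_pwDl// sqr_ge0.
  have [v1|/ltW v1] := leP v 1%R.
    apply: (@le_trans _ _ (1 * 2)%R).
      rewrite ler_pM ?addr_ge0 ?sqr_ge0 ?expR_ge0//.
        by rewrite -expR0 ler_expR oppr_le0 powR_ge0.
      by rewrite -[leRHS]/(1 + 1)%R lerD2l expr_le1.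
    by rewrite mul1r /C ler_peMr// ler1n fact_gt0.
  rewrite expRN mulrC ler_pdivrMr ?expR_gt0// /C -mulrA.
  apply: (@le_trans _ _ (2 * v ^+ 2)%R).
    by rewrite mulr_natl mulr2n lerD2r exprn_ege1.
  rewrite ler_pM2l//.
  apply: (@le_trans _ _ ((v `^ p) ^+ n.+1)%R).
    by rewrite -powR_mulrn// -powR_mulrn ?powR_ge0// -powRrM ler_powR.
  have := @expR_ge1Dxn R (v `^ p) n (powR_ge0 _ _).
  rewrite -ler_pdivrMl ?ltr0n ?fact_gt0// mulrC; apply: le_trans.
  by rewrite lerDr.
apply: (@le_lt_trans _ _ (\int[leb]_x (C%:E * ((1 + x ^+ 2)^-1)%:E))).
  apply: ge0_le_integral => //.
  - by apply: measurable_funTS; exact: measurable_gauss_mix.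
  - apply: measurable_funTS; apply/measurable_EFinP; apply: measurable_funM => //.
    exact: measurable_inv1Dx2.
  - by move=> x _; rewrite -EFinM lee_fin -(real_normK (num_real x)) bnd.
rewrite ge0_integralZl_EFin//.
- by rewrite lte_mul_pinfty ?lee_fin// ?mulr_ge0// integral_inv1Dx2_lty.
- by move=> x _; rewrite lee_fin invr_ge0 addr_ge0// sqr_ge0.
- apply: measurable_funTS; apply/measurable_EFinP; exact: measurable_inv1Dx2.
- by rewrite /C mulr_ge0.
Qed.

Lemma gauss_mix1_gt0 : 0 < gauss_mix 1.
Proof.
apply: (@lt_le_trans _ _ (\int[leb]_(v in `[0%R, 1%R]) (expR (- 1))%:E)).
  rewrite integral_cst//= lebesgue_measure_itv/= lte_fin ltr01.
  by rewrite oppr0 adde0 mule1 lte_fin expR_gt0.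
apply: (@le_trans _ _ (\int[leb]_(v in `[0%R, 1%R]) (expR (- (`|v| `^ p * 1)))%:E)).
  apply: ge0_le_integral => //.
  - by apply: measurable_funTS; exact: measurable_gauss_mix.
  - move=> x /=; rewrite in_itv/= => /andP[x0 x1].
    rewrite lee_fin ler_expR lerN2 mulr1 ger0_norm//.
    have := @ge0_ler_powR R p (ltW p0) x 1%R; rewrite powR1; apply => //.
    by rewrite nnegrE.
apply: ge0_subset_integral => //.
- by apply: measurable_funTS; exact: measurable_gauss_mix.
Qed.

End riesz_mixture.

(** * The Gaussian kernel is positive semidefinite *)

Section gauss_kernel.
Context (R : realType) (n : nat).
Local Notation Rn := 'rV[R]_n.

Definition sqd (x y : Rn) : R := \sum_(i < n) (x ord0 i - y ord0 i) ^+ 2.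

(** As a function of the pair, because it is used as a kernel. *)
Definition gauss (t : R) (p : Rn * Rn) : R := expR (- (t * sqd p.1 p.2)).

Lemma sqd_ge0 x y : 0 <= sqd x y.
Proof. by apply: sumr_ge0 => i _; exact: sqr_ge0. Qed.

Lemma sqdC x y : sqd x y = sqd y x.
Proof. by apply: eq_bigr => i _; rewrite -sqrrN opprB. Qed.

Lemma sqd_eq0 x y : (sqd x y == 0) = (x == y).
Proof.
apply/idP/eqP => [|->]; last by rewrite /sqd big1// => i _; rewrite subrr expr0n.
rewrite psumr_eq0 => [|i _]; last exact: sqr_ge0.
move=> /allP xy; apply/rowP => i; apply/eqP.
by have := xy i (mem_index_enum i); rewrite sqrf_eq0 subr_eq0.
Qed.

Lemma continuous_measurable_rV (f : Rn -> R) : continuous f -> measurable_fun setT f.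
Proof.
move=> cf; apply: (measurability _ (RGenOpens.measurableE R)) => _ [_ [a [b ->] <-]].
rewrite setTI; apply: sub_sigma_algebra; apply: open_comp => //.
Qed.

Lemma measurable_coord (i : 'I_n) : measurable_fun setT (fun x : Rn => x ord0 i).
Proof. apply: continuous_measurable_rV; exact: coord_continuous. Qed.

Lemma measurable_sqd : measurable_fun setT (fun p : Rn * Rn => sqd p.1 p.2).
Proof.
apply: measurable_sum => i; apply: measurable_funX; apply: measurable_funB.
  exact: (measurableT_comp (measurable_coord i) measurable_fst).
exact: (measurableT_comp (measurable_coord i) measurable_snd).
Qed.

Lemma measurable_sqdl z : measurable_fun setT (sqd ^~ z).
Proof.
apply: measurable_sum => i; apply: measurable_funX; apply: measurable_funB => //.
exact: measurable_coord.
Qed.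

Lemma measurable_gauss t : measurable_fun setT (gauss t).
Proof.
apply: (measurableT_comp (@measurable_expR R)); apply: measurable_funN.
by apply: measurable_funM => //; exact: measurable_sqd.
Qed.

Lemma gauss_ge0 t p : 0 <= gauss t p.
Proof. exact: expR_ge0. Qed.

Lemma gauss_le1 t p : 0 <= t -> gauss t p <= 1.
Proof. by move=> t0; rewrite -expR0 ler_expR oppr_le0 mulr_ge0// sqd_ge0. Qed.

Lemma normr_gauss_le1 t p : 0 <= t -> `|gauss t p| <= 1.
Proof. by move=> t0; rewrite ger0_norm ?gauss_ge0 ?gauss_le1. Qed.

Lemma bmf_gauss t : 0 <= t -> bmf (gauss t).
Proof.
move=> t0; split; first exact: measurable_gauss.
by exists 1 => x; exact: normr_gauss_le1.
Qed.

(** The cross term of |x - y|^2 is isolated, to which [psd_exp] applies. *)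
Lemma gauss_factor t x y : gauss t (x, y) =
  expR (- (t * sqd x 0)) * expR (- (t * sqd y 0)) *
  expR (2 * t * \sum_(i < n) x ord0 i * y ord0 i).
Proof.
rewrite -!expRD; congr expR; rewrite /sqd/= !mulr_sumr -!sumrN -!big_split/=.
by apply: eq_bigr => i _; rewrite !mxE; ring.
Qed.

(** By [gauss_factor] this is [psd_exp] multiplied by a tensor, except that the
    coordinates are unbounded.  They are cut off outside the ball of squared
    radius M, and the cutoff is removed by [psd_cvg], the Gaussian being at
    most one. *)
Lemma psd_gauss (l l' : {finite_measure set Rn -> \bar R}) c z (t : R) :
  0 <= t -> psd l l' c z (gauss t).
Proof.
move=> t0.
pose cut (M : nat) (x : Rn) : R := if sqd x 0 <= M%:R then 1 else 0.
have msq : measurable_fun setT (fun x : Rn => sqd x 0).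
  exact: measurable_sqdl.
have cut01 M x : 0 <= cut M x <= 1 by rewrite /cut; case: ifP; rewrite ?lexx ?ler01.
have mcut M : measurable_fun setT (cut M).
  by apply: measurable_fun_ifT => //; exact: measurable_fun_ler.
pose h M x := expR (- (t * sqd x 0)) * cut M x.
pose g M (i : 'I_n) (x : Rn) := x ord0 i * cut M x.
have bh M : bmf (h M).
  split.
    apply: measurable_funM => //; apply: (measurableT_comp (@measurable_expR R)).
    by apply: measurable_funN; apply: measurable_funM.
  exists 1 => x; have /andP[c0 c1] := cut01 M x.
  rewrite ger0_norm ?mulr_ge0 ?expR_ge0// mulr_ile1 ?expR_ge0//.
  by rewrite -expR0 ler_expR oppr_le0 mulr_ge0// sqd_ge0.
have bg M i : bmf (g M i).
  split; first by apply: measurable_funM => //; exact: measurable_coord.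
  exists (M%:R + 1) => x; rewrite /g /cut; case: ifP => [xM|_]; last first.
    by rewrite mulr0 normr0 addr_ge0.
  rewrite mulr1; have : x ord0 i ^+ 2 <= M%:R.
    apply: le_trans xM; rewrite /sqd (bigD1 i)//= mxE subr0 lerDl.
    by apply: sumr_ge0 => j _; exact: sqr_ge0.
  rewrite -real_normK ?num_real// => xi2.
  have [//|xM1] := leP `|x ord0 i| (M%:R + 1).
  have M1 : 1 <= M%:R + 1 :> R by rewrite lerDr.
  have : M%:R + 1 <= `|x ord0 i| ^+ 2.
    by rewrite expr2 (le_trans (ltW xM1))// ler_peMl// (le_trans M1 (ltW xM1)).
  by move=> /le_trans/(_ xi2); rewrite gerDl ler10.
apply: (@psd_cvg _ _ _ _ _ _ _ (fun M p => h M p.1 * h M p.2 *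
    (expR (2 * t * \sum_(i < n) g M i p.1 * g M i p.2) * 1)) _ 1).
- move=> M; apply: psd_tensor => //.
  by apply: psd_exp => //; [rewrite mulr_ge0|exact: psd1].
- move=> M [x y] /=; rewrite mulr1 /h /g /cut.
  case: ifP => _; last by rewrite !(mulr0, mul0r) normr0.
  case: ifP => _; last by rewrite !(mulr0, mul0r) normr0.
  under eq_bigr do rewrite !mulr1.
  by rewrite !mulr1 -gauss_factor normr_gauss_le1.
- move=> [x y] /=; apply: cvg_near_cst.
  near=> M; rewrite mulr1 /h /g /cut.
  have -> : sqd x 0 <= M%:R by near: M; exact: nbhs_infty_ger.
  have -> : sqd y 0 <= M%:R by near: M; exact: nbhs_infty_ger.
  under eq_bigr do rewrite !mulr1.
  by rewrite !mulr1 -gauss_factor.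
Unshelve. all: by end_near. Qed.

End gauss_kernel.

(** * Gaussian transforms determine finite measures *)

(** With the exponent m(ma - 1) instead of ma the limit at a = 0 is 1, so the
    limit is an exact indicator function. *)
Lemma expRN_expR_cvg (R : realType) (a : R) :
  expR (- expR (m.+1%:R * (m.+1%:R * a - 1))) @[m --> \oo] -->
  (if 0 < a then 0 else 1 : R).
Proof.
have e0 : expR (- m.+1%:R) @[m --> \oo] --> (0 : R).
  by have := @cvgn_expR R; rewrite -(cvg_shiftS _).
case: ltP => a0.
  apply: (@squeeze_cvgr _ _ _ _ (cst 0) (fun m : nat => expR (- m.+1%:R))) => //.
    near=> m; rewrite expR_ge0/= ler_expR lerN2.
    have am : 2 <= m.+1%:R * a.
      rewrite -ler_pdivrMr//; apply: (@le_trans _ _ m%:R); last by rewrite ler_nat.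
      by near: m; exact: nbhs_infty_ger.
    apply: (@le_trans _ _ (m.+1%:R * (m.+1%:R * a - 1))).
      by rewrite ler_peMr// lerBrDr.
    by apply: le_trans (expR_ge1Dx _); rewrite lerDr.
  exact: cvg_cst.
apply: (@squeeze_cvgr _ _ _ _ (fun m : nat => 1 - expR (- m.+1%:R)) (cst 1)).
- near=> m; apply/andP; split; last first.
    by rewrite -expR0 ler_expR oppr_le0 expR_ge0.
  apply: le_trans (expR_ge1Dx _); rewrite lerD2l lerN2 ler_expR.
  rewrite mulrBr mulr1 gerDr mulr_ge0_le0// mulr_ge0_le0//.
- rewrite -[X in _ --> X]subr0; apply: cvgB => //; exact: cvg_cst.
- exact: cvg_cst.
Unshelve. all: by end_near. Qed.

Section gauss_determines.
Context (R : realType) (n : nat).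
Local Notation Rn := 'rV[R]_n.
Variables (l l' : {finite_measure set Rn -> \bar R}).
Local Notation E := (signed_int l l' 0 0).

(** Functions that cannot be distinguished from zero by l - l', even after
    multiplication by a Gaussian; the Gaussian factor makes the class stable
    under multiplication by Gaussians. *)
Definition annihilated (h : Rn -> R) :=
  bmf h /\ forall (t : R) (z : Rn), 0 < t -> E (fun x => h x * gauss t (x, z)) = 0.

(** Completing the square: the new centre is the weighted mean of w and z. *)
Lemma gaussM (s t : R) (x w z : Rn) : 0 < s -> 0 < t ->
  gauss s (x, w) * gauss t (x, z) =
  expR (- (s * t / (s + t) * sqd w z)) *
  gauss (s + t) (x, (s + t)^-1 *: (s *: w + t *: z)).
Proof.
move=> s0 t0; have st0 : s + t != 0 by rewrite gt_eqF// addr_gt0.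
rewrite /gauss/= -!expRD; congr expR; rewrite /sqd !mulr_sumr -!sumrN -!big_split/=.
by apply: eq_bigr => i _; rewrite !mxE; field.
Qed.

Lemma bmf_gaussl (t : R) (z : Rn) : 0 <= t -> bmf (fun x => gauss t (x, z)).
Proof.
move=> t0; split; last by exists 1 => x; exact: normr_gauss_le1.
exact: (measurableT_comp (measurable_gauss t) (pair2_measurable z)).
Qed.

Lemma annihilatedD h k : annihilated h -> annihilated k ->
  annihilated (fun x => h x + k x).
Proof.
move=> [bh h0] [bk k0]; split=> [|t z t0]; first exact: bmfD.
have bg := bmf_gaussl z (ltW t0).
under eq_fun do rewrite mulrDl.
by rewrite signed_intD ?h0 ?k0 ?addr0//; exact: bmfM.
Qed.

Lemma annihilatedZ r h : annihilated h -> annihilated (fun x => r * h x).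
Proof.
move=> [bh h0]; split=> [|t z t0]; first by apply: bmfM => //; exact: bmf_cst.
have bg := bmf_gaussl z (ltW t0).
under eq_fun do rewrite -mulrA.
by rewrite signed_intZ ?h0 ?mulr0//; exact: bmfM.
Qed.

Lemma annihilated_gauss (s : R) w h : 0 < s -> annihilated h ->
  annihilated (fun x => gauss s (x, w) * h x).
Proof.
move=> s0 [bh h0]; split=> [|t z t0].
  by apply: bmfM => //; apply: bmf_gaussl; exact: ltW.
under eq_fun do rewrite mulrAC gaussM// mulrC mulrCA.
rewrite signed_intZ; first by rewrite h0 ?mulr0// addr_gt0.
by apply: bmfM => //; apply: bmf_gaussl; rewrite addr_ge0 ?ltW.
Qed.

Lemma annihilated_cvg (h_ : nat -> Rn -> R) h (M : R) :
  (forall n, annihilated (h_ n)) -> (forall n x, `|h_ n x| <= M) ->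
  (forall x, h_ n x @[n --> \oo] --> h x) -> annihilated h.
Proof.
move=> ah hM hh; split=> [|t z t0].
  split; first by apply: (measurable_fun_cvg (fun n => (ah n).1.1)) => x _; exact: hh.
  exists M => x; have /cvg_norm hhx := hh x.
  apply: (cvgr_to_le hhx); exact: nearW.
have : E (fun x => h_ n x * gauss t (x, z)) @[n --> \oo] -->
    E (fun x => h x * gauss t (x, z)).
  apply: (@signed_int_cvg _ _ _ _ _ _ _ _ _ M).
  - move=> k; apply: measurable_funM; first exact: (ah k).1.1.
    exact: (bmf_gaussl z (ltW t0)).1.
  - move=> k x; rewrite normrM -[leRHS]mulr1 ler_pM//.
    by apply: normr_gauss_le1; exact: ltW.
  - by move=> x; apply: cvgMr_tmp; exact: hh.
under eq_fun do rewrite (ah _).2//.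
by move=> /cvg_lim <- //; rewrite lim_cst.
Qed.

(** Each power of the Gaussian in the exponential series is absorbed by
    [annihilated_gauss], and the partial sums are bounded. *)
Lemma annihilated_expN c (t : R) w h : 0 < t -> annihilated h ->
  annihilated (fun x => expR (- (c * gauss t (x, w))) * h x).
Proof.
move=> t0 ah.
pose s x := - (c * gauss t (x, w)).
have sM x : `|s x| <= `|c|.
  by rewrite /s normrN normrM -[leRHS]mulr1 ler_pM// normr_gauss_le1// ltW.
have as_ k : annihilated (fun x => s x ^+ k * h x).
  elim: k => [|k ih]; first by under eq_fun do rewrite expr0 mul1r.
  have -> : (fun x => s x ^+ k.+1 * h x) =
      (fun x => - c * (gauss t (x, w) * (s x ^+ k * h x))).
    by apply/funext => x; rewrite exprS -mulrA {1}/s -mulNr -mulrA.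
  exact/annihilatedZ/annihilated_gauss.
have [mh [N hN]] := ah.1.
apply: (@annihilated_cvg (fun k x => series (exp_coeff (s x)) k * h x) _ (expR `|c| * N)).
- elim=> [|k ih].
    rewrite /series/=; under eq_fun do rewrite big_geq//; exact: annihilatedZ.
  under eq_fun do rewrite seriesSr mulrDl.
  apply: annihilatedD; first exact: ih.
  rewrite /exp_coeff/=; under eq_fun do rewrite mulrAC mulrC.
  exact: annihilatedZ.
- by move=> k x; rewrite normrM ler_pM// normr_series_exp_coeff_le.
- by move=> x; apply: cvgMr_tmp; exact: is_cvg_series_exp_coeff.
Qed.

(** Multiplication by all annihilated functions, and not only by 1, is required
    so that the class is visibly stable under intersections: it is a
    sigma-algebra, without an appeal to the monotone class theorem. *)
Definition preserving (B : set Rn) :=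
  measurable B /\ forall h, annihilated h -> annihilated (fun x => \1_B x * h x).

Lemma preservingC B : preserving B -> preserving (~` B).
Proof.
move=> [mB sB]; split=> [|h ah]; first exact: measurableC.
have := annihilatedD ah (annihilatedZ (-1) (sB _ ah)).
congr annihilated; apply/funext => x; rewrite !indicE in_setC.
by case: (x \in B) => /=; ring.
Qed.

(** The indicator of the complement of the union is the pointwise limit of the
    finite products of the indicators of the complements. *)
Lemma preserving_bigcup (F : (set Rn)^nat) :
  (forall k, preserving (F k)) -> preserving (\bigcup_k F k).
Proof.
move=> sF; rewrite -[X in preserving X]setCK setC_bigcup; apply: preservingC.
split; first by apply: bigcap_measurableType => k _; exact: (preservingC (sF k)).1.
move=> h ah; have [mh [N hN]] := ah.1.
have i1 B (x : Rn) : `|\1_B x| <= 1 :> R.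
  by rewrite indicE; case: (_ \in _); rewrite ?normr1 ?normr0.
apply: (@annihilated_cvg (fun k x => \prod_(i < k) \1_(~` F i) x * h x) _ (1 * N)).
- elim=> [|k ih]; first by under eq_fun do rewrite big_ord0 mul1r.
  under eq_fun do rewrite big_ord_recr/= mulrAC mulrC.
  exact: (preservingC (sF k)).2.
- move=> k x; rewrite normrM ler_pM// normr_prod.
  by apply: prodr_ile1 => i _; rewrite normr_ge0 i1.
- move=> x; apply: cvgMr_tmp; apply: cvg_near_cst.
  rewrite indicE; have [|] := boolP (x \in _); rewrite ?notin_setE ?inE => xF.
    apply: nearW => k; apply/eqP; rewrite big1// => i _.
    by rewrite indicE mem_set//; exact: xF.
  have [k Fk] : exists k, F k x.
    by apply: contrapT => /forallNP nF; apply: xF => k _; exact: nF.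
  near=> m; have km : (k < m)%N by near: m; exact: nbhs_infty_gt.
  rewrite (bigD1 (Ordinal km))//= indicE memNset ?mul0r// => /(_ Fk).
Unshelve. all: by end_near. Qed.

(** By [expRN_expR_cvg] with a = r - |x - w|^2, the indicator of the complement
    of the ball is the limit of exp(-c_m g_m), where g_m is the Gaussian of
    parameter m^2 centred at w and c_m = exp(m(mr - 1)). *)
Lemma preserving_ball (w : Rn) (r : R) : preserving [set x | sqd x w < r].
Proof.
rewrite -[X in preserving X]setCK; apply: preservingC.
have mB : measurable [set x : Rn | sqd x w < r].
  rewrite -[X in measurable X]setTI; apply: measurable_fun_ltr => //.
  exact: measurable_sqdl.
split; first exact: measurableC.
move=> h ah; have [mh [N hN]] := ah.1.
apply: (@annihilated_cvg (fun m x => expR (- (expR (m.+1%:R * (m.+1%:R * r - 1)) *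
   gauss (m.+1%:R ^+ 2) (x, w))) * h x) _ (1 * N)).
- by move=> m; apply: annihilated_expN => //; rewrite exprn_gt0.
- move=> m x; rewrite normrM ler_pM// ger0_norm ?expR_ge0//.
  by rewrite -expR0 ler_expR oppr_le0 mulr_ge0 ?expR_ge0.
- move=> x; apply: cvgMr_tmp.
  have -> : \1_(~` [set x | sqd x w < r]) x = (if 0 < r - sqd x w then 0 else 1 : R).
    rewrite subr_gt0 indicE; case: ifPn => d; first by rewrite memNset//=; apply.
    by rewrite mem_set//=; exact/negP.
  have -> : (fun m : nat => expR (- (expR (m.+1%:R * (m.+1%:R * r - 1)) *
      gauss (m.+1%:R ^+ 2) (x, w)))) =
      (fun m : nat => expR (- expR (m.+1%:R * (m.+1%:R * (r - sqd x w) - 1)))).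
    by apply/funext => m; rewrite /gauss/= -expRD; congr (expR (- expR _)); ring.
  exact: expRN_expR_cvg.
Qed.

Lemma preserving_sigma_algebra : sigma_algebra setT preserving.
Proof.
split; [|by move=> B sB; rewrite setTD; exact: preservingC|exact: preserving_bigcup].
split; first exact: measurable0.
move=> h ah; have := annihilatedZ 0 ah; congr annihilated.
by apply/funext => x; rewrite indic0.
Qed.

(** A countable union of Euclidean balls, as the topology is that of the sup
    norm.  The radii 1/(k+1) bound the squared distances. *)
Lemma open_bigcup_ball (U : set Rn) : open U ->
  U = \bigcup_(i in [set i : 'rV[rat]_n * nat |
      [set x | sqd x (map_mx ratr i.1) < i.2.+1%:R^-1] `<=` U])
    [set x | sqd x (map_mx ratr i.1) < i.2.+1%:R^-1].
Proof.
move=> oU; apply/seteqP; split => [x Ux|x [i iU]]; last exact: iU.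
have /nbhs_ballP[e /= e0 xeU] : nbhs x U by exact: open_nbhs_nbhs.
pose r := e / 2; have r0 : 0 < r by rewrite divr_gt0.
have [k kr] : exists k : nat, k.+1%:R^-1 < r ^+ 2.
  exists (Num.trunc (r ^+ 2)^-1); rewrite invf_plt ?posrE ?exprn_gt0//.
  have : 0 <= (r ^+ 2)^-1 by rewrite invr_ge0 exprn_ge0// ltW.
  by move=> /truncn_itv/andP[].
(* n d^2 < 1/(k+1), and the ball of centre q lies within 2r = e of x *)
pose d := Num.min r (n.+1%:R * k.+1%:R)^-1.
have d0 : 0 < d by rewrite lt_min r0 invr_gt0 mulr_gt0.
have d1 : d <= 1.
  rewrite ge_min; apply/orP; right; rewrite invf_le1 ?mulr_gt0//.
  by rewrite -natrM ler1n muln_gt0.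
have qP i : {q : rat | x ord0 i - d < ratr q < x ord0 i + d}.
  apply: cid; have : x ord0 i - d < x ord0 i + d by rewrite ltrD2l gt0_cp.
  by move=> /rat_in_itvoo[q]; rewrite in_itv/=; exists q.
pose q : 'rV[rat]_n := \row_i sval (qP i).
have xq i : `|x ord0 i - ratr (q ord0 i)| < d.
  by rewrite distrC ltr_distl mxE; case: (qP i).
have sq : sqd x (map_mx ratr q) < k.+1%:R^-1.
  apply: (@le_lt_trans _ _ (\sum_(i < n) d)).
    apply: ler_sum => i _; rewrite mxE -real_normK ?num_real//.
    by rewrite expr2 -[leRHS]mulr1 ler_pM// ?(le_trans _ d1)// ltW.
  rewrite sumr_const card_ord.
  apply: (@le_lt_trans _ _ ((n.+1%:R * k.+1%:R)^-1 * n%:R)).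
    by rewrite -[d *+ n]mulr_natr; apply: ler_wpM2r => //; rewrite ge_min lexx orbT.
  rewrite invfM mulrAC -[ltRHS]mul1r ltr_pM2r ?invr_gt0//.
  by rewrite mulrC ltr_pdivrMr// mul1r ltr_nat.
exists (q, k) => //= y /= yq; apply: xeU; split=> // i j; rewrite ord1.
have yqj : `|y ord0 j - ratr (q ord0 j)| < r.
  rewrite -(@ltr_pXn2r _ 2) ?nnegrE ?(ltW r0)// real_normK ?num_real//.
  apply: le_lt_trans (lt_trans yq kr); rewrite /sqd (bigD1 j)//=.
  rewrite [map_mx _ _ _ _]mxE lerDl.
  by apply: sumr_ge0 => m _; exact: sqr_ge0.
rewrite /ball/= -(subrK (ratr (q ord0 j)) (x ord0 j)) -addrA.
rewrite (le_lt_trans (ler_normD _ _))// (splitr e) ltrD//.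
  by rewrite (lt_le_trans (xq j))// ge_min lexx.
by rewrite distrC.
Qed.

Lemma preserving_open (U : set Rn) : open U -> preserving U.
Proof.
move=> oU; rewrite (open_bigcup_ball oU).
pose S := g_sigma_algebraType preserving.
suff: @measurable _ S (\bigcup_(i in [set i : 'rV[rat]_n * nat |
      [set x | sqd x (map_mx ratr i.1) < i.2.+1%:R^-1] `<=` U])
    [set x | sqd x (map_mx ratr i.1) < i.2.+1%:R^-1]).
  by rewrite /measurable/= sigma_algebra_id//; exact: preserving_sigma_algebra.
rewrite bigcup_mkcond; apply: countable_bigcupT_measurable => [|i].
  exact: countableP.
case: ifPn => _; last exact: measurable0.
by apply: sub_sigma_algebra; exact: preserving_ball.
Qed.

Lemma preserving_borel (B : set Rn) : measurable B -> preserving B.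
Proof.
move=> mB; apply: (smallest_sub preserving_sigma_algebra preserving_open); exact: mB.
Qed.

Hypothesis gaussE : forall (t : R) (z : Rn), 0 < t ->
  E (fun x => gauss t (x, z)) = 0.

(** The indicator of B is annihilated by [preserving_borel]; the remaining
    Gaussian factor tends to 1 as its parameter tends to 0. *)
Lemma gauss_determines (B : set Rn) : measurable B -> l B = l' B.
Proof.
move=> mB.
have a1 : annihilated (fun=> 1).
  split=> [|t z t0]; first exact: bmf_cst.
  by under eq_fun do rewrite mul1r; exact: gaussE.
have [bB aB] := (preserving_borel mB).2 _ a1.
have : E (fun x => \1_B x * 1 * gauss m.+1%:R^-1 (x, 0)) @[m --> \oo] --> E (\1_B).
  apply: (@signed_int_cvg _ _ _ _ _ _ _ _ _ 1).
  - move=> m; apply: measurable_funM; first exact: bB.1.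
    by apply: (bmf_gaussl 0 _).1; rewrite invr_ge0.
  - move=> m x; rewrite mulr1 normrM -[leRHS]mulr1 ler_pM//.
      by rewrite indicE; case: (_ \in _); rewrite ?normr1 ?normr0.
    by apply: normr_gauss_le1; rewrite invr_ge0.
  - move=> x; rewrite -[X in _ --> X]mulr1; under eq_fun do rewrite mulr1.
    apply: cvgMl_tmp; rewrite /gauss/=; set s := sqd x 0.
    rewrite [X in _ --> X](_ : _ = expR (- (0 * s))); last by rewrite mul0r oppr0 expR0.
    have ms : - (m.+1%:R^-1 * s) @[m --> \oo] --> - (0 * s).
      by apply: cvgN; apply: cvgMr_tmp; exact: cvg_harmonic.
    exact: (cvg_comp _ _ ms (@continuous_expR R _)).
under eq_fun do rewrite aB ?invr_gt0//.
move=> /cvg_lim; rewrite lim_cst// => /(_ (@norm_hausdorff _ _))/esym.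
rewrite /signed_int mul0r addr0 => /subr0_eq.
rewrite /Rintegral !integral_indic// !setIT => lB.
by rewrite -[LHS]fineK ?fin_num_measure// lB fineK// fin_num_measure.
Qed.

End gauss_determines.

(** * Riesz energies as integrals of Gaussian energies *)

Section riesz_energy.
Context (R : realType) (n : nat) (alpha : R).
Hypothesis alphan : alpha < n%:R.
Local Notation Rn := 'rV[R]_n.
Local Notation leb := (@lebesgue_measure R).
Local Open Scope ereal_scope.

Let p : R := (2 / (n%:R - alpha))%R.

Let p_gt0 : (0 < p)%R. Proof. by rewrite divr_gt0// subr_gt0. Qed.

Lemma riesz_ge0 (x y : Rn) : 0 <= riesz alpha x y.
Proof. by rewrite /riesz; case: ifP => // _; rewrite lee_fin powR_ge0. Qed.

(** On the diagonal both sides are infinite, since the Gaussians are 1 there. *)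
Lemma gauss_mix_riesz (x y : Rn) : gauss_mix p (sqd x y) = gauss_mix p 1 * riesz alpha x y.
Proof.
rewrite /riesz; case: eqVneq => [->|xy].
  have /eqP -> : sqd y y == 0%R by rewrite sqd_eq0.
  by rewrite gauss_mix0 gt0_muley// gauss_mix1_gt0.
have d0 : (0 < sqd x y)%R by rewrite lt_neqAle eq_sym sqd_eq0 xy sqd_ge0.
rewrite gauss_mix_scale// muleC; congr (_ * (_)%:E).
have -> : euclid_norm (x - y) = (sqd x y `^ 2^-1)%R.
  rewrite powR12_sqrt ?sqd_ge0// /euclid_norm; congr Num.sqrt.
  by apply: eq_bigr => i _; rewrite !mxE.
rewrite -powRrM; congr (_ `^ _)%R; rewrite /p invf_div -mulNr opprB; exact: mulrC.
Qed.

Lemma measurable_riesz : measurable_fun setT (fun z : Rn * Rn => riesz alpha z.1 z.2).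
Proof.
rewrite /riesz; apply: measurable_fun_ifT => //=.
  under eq_fun do rewrite -sqd_eq0.
  by apply: measurable_fun_eqr => //; exact: measurable_sqd.
apply/measurable_EFinP; apply: (measurableT_comp (measurable_powR _)).
have -> : (fun z : Rn * Rn => euclid_norm (z.1 - z.2)) = (fun z => sqd z.1 z.2 `^ 2^-1)%R.
  apply/funext => z; rewrite powR12_sqrt ?sqd_ge0// /euclid_norm; congr Num.sqrt.
  by apply: eq_bigr => i _; rewrite !mxE.
apply: (measurableT_comp (measurable_powR _)); exact: measurable_sqd.
Qed.

(** Iterated integrals rather than an integral on the product space, since the
    inner integral is a potential. *)
Definition mutual (m m' : set Rn -> \bar R) := \int[m]_x \int[m']_y riesz alpha x y.

Definition gmutual (m m' : set Rn -> \bar R) t :=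
  \int[m]_x \int[m']_y (gauss t (x, y))%:E.

Lemma mutual_ge0 (m m' : {measure set Rn -> \bar R}) : 0 <= mutual m m'.
Proof. by apply: integral_ge0 => x _; apply: integral_ge0 => y _; exact: riesz_ge0. Qed.

Lemma gmutual_ge0 (m m' : {measure set Rn -> \bar R}) t : 0 <= gmutual m m' t.
Proof.
by apply: integral_ge0 => x _; apply: integral_ge0 => y _; rewrite lee_fin gauss_ge0.
Qed.

Lemma measurable_mixture :
  measurable_fun setT (fun q : Rn * Rn * R => (gauss (`|q.2| `^ p)%R q.1)%:E).
Proof.
apply/measurable_EFinP; apply: (measurableT_comp (@measurable_expR R)).
apply: measurable_funN; apply: measurable_funM.
  apply: (measurableT_comp (measurable_powR p)).
  by apply: (measurableT_comp (@normr_measurable R setT)).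
exact: (measurableT_comp (@measurable_sqd R n) measurable_fst).
Qed.

Section mixture.
Variables m m' : {sigma_finite_measure set Rn -> \bar R}.

Lemma measurable_gmutual : measurable_fun setT (fun v : R => gmutual m m' (`|v| `^ p)%R).
Proof.
pose F (q : R * Rn) := \int[m']_y (gauss (`|q.1| `^ p)%R (q.2, y))%:E.
apply: (measurable_fun_fubini_tonelli_F (m2 := m) (F)); last first.
  by move=> q; rewrite /F; apply: integral_ge0 => ? _; rewrite lee_fin gauss_ge0.
apply: (measurable_fun_fubini_tonelli_F (m2 := m')
    (fun q : (R * Rn) * Rn => (gauss (`|q.1.1| `^ p)%R (q.1.2, q.2))%:E)); last first.
  by move=> q; rewrite lee_fin gauss_ge0.
apply: (measurableT_comp measurable_mixture
  (g := fun q : (R * Rn) * Rn => ((q.1.2, q.2), q.1.1))).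
by do ?apply: measurable_fun_pair; do ?exact: measurableT_comp.
Qed.

Lemma measurable_potential : measurable_fun setT (fun x => \int[m']_y riesz alpha x y).
Proof.
apply: (measurable_fun_fubini_tonelli_F (m2 := m')
    (fun q => riesz alpha q.1 q.2)); last first.
  by move=> q; exact: riesz_ge0.
exact: measurable_riesz.
Qed.

(** Tonelli's theorem, used twice. *)
Lemma mutual_mixture : gauss_mix p 1 * mutual m m' = \int[leb]_v gmutual m m' (`|v| `^ p)%R.
Proof.
rewrite /mutual -ge0_integralZl//; last 3 first.
- exact: measurable_potential.
- by move=> x _; apply: integral_ge0 => y _; exact: riesz_ge0.
- exact: gauss_mix_ge0.
pose F (q : Rn * R) := \int[m']_y (gauss (`|q.2| `^ p)%R (q.1, y))%:E.
transitivity (\int[m]_x \int[leb]_v F (x, v)).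
  apply: eq_integral => x _; rewrite -ge0_integralZl//; last 3 first.
  - exact: (measurableT_comp measurable_riesz (pair1_measurable x)).
  - by move=> y _; exact: riesz_ge0.
  - exact: gauss_mix_ge0.
  under eq_integral do rewrite -gauss_mix_riesz.
  apply: (fubini_tonelli (m1 := m') (m2 := leb)
    (fun q : Rn * R => (gauss (`|q.2| `^ p)%R (x, q.1))%:E)).
    apply: (measurableT_comp measurable_mixture (g := fun q : Rn * R => ((x, q.1), q.2))).
    by do ?apply: measurable_fun_pair; do ?exact: measurableT_comp.
  by move=> q; rewrite lee_fin gauss_ge0.
apply: (fubini_tonelli (m1 := m) (m2 := leb) F).
  apply: (measurable_fun_fubini_tonelli_F (m2 := m')
    (fun q : (Rn * R) * Rn => (gauss (`|q.1.2| `^ p)%R (q.1.1, q.2))%:E)); last first.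
    by move=> q; rewrite lee_fin gauss_ge0.
  apply: (measurableT_comp measurable_mixture
    (g := fun q : (Rn * R) * Rn => ((q.1.1, q.2), q.1.2))).
  by do ?apply: measurable_fun_pair; do ?exact: measurableT_comp.
by move=> q; rewrite /F; apply: integral_ge0 => ? _; rewrite lee_fin gauss_ge0.
Qed.

End mixture.

Section finite.
Implicit Types l : {finite_measure set Rn -> \bar R}.

Let Gr l l' t : R := (\int[l]_x \int[l']_y gauss t (x, y))%R.

Lemma gmutualE l l' (t : R) : (0 <= t)%R -> gmutual l l' t = (Gr l l' t)%:E.
Proof.
move=> t0; have bg := @bmf_gauss R n t t0.
rewrite /gmutual /Gr /Rintegral fineK; last first.
  exact: (integrable_fin_num _ (bmf_integrable l (bmf_Rintegral l' bg))).
apply: eq_integral => x _; rewrite fineK//.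
exact: (integrable_fin_num _ (bmf_integrable l' (bmf_pair1 x bg))).
Qed.

Lemma signed_int2_gauss l l' (t : R) : (0 <= t)%R ->
  signed_int2 l l' 0%R 0%R (gauss t) = (Gr l l t + Gr l' l' t - (Gr l l' t + Gr l' l t))%R.
Proof.
move=> t0; have bg := @bmf_gauss R n t t0.
have bR (m : {finite_measure set Rn -> \bar R}) := bmf_Rintegral m bg.
rewrite /signed_int2 {1}/signed_int mul0r addr0.
have E x : signed_int l l' 0%R 0%R (fun y => gauss t (x, y)) =
    (\int[l]_y gauss t (x, y) - \int[l']_y gauss t (x, y))%R.
  by rewrite /signed_int mul0r addr0.
under eq_Rintegral do rewrite E.
under [X in (_ - X)%R]eq_Rintegral do rewrite E.
rewrite !RintegralB//; try exact: bmf_integrable.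
by rewrite /Gr; ring.
Qed.

Lemma signed_int2_gauss_ge0 l l' (t : R) : (0 <= t)%R ->
  (0 <= signed_int2 l l' 0%R 0%R (gauss t))%R.
Proof.
move=> t0; have [_ /(_ (fun=> 1%R) (bmf_cst _ _))] := @psd_gauss R n l l' 0%R 0%R t t0.
by under eq_fun do rewrite !mul1r.
Qed.

(** Write u for the Gaussian transform of l - l' at z.  The Gaussian energy of
    l - l' + c delta_z is 2cu + c^2, and c = -u makes it -u^2. *)
Lemma signed_int_gauss_eq0 l l' (t : R) (z : Rn) : (0 <= t)%R ->
  signed_int2 l l' 0%R 0%R (gauss t) = 0%R ->
  signed_int l l' 0%R 0%R (fun x => gauss t (x, z)) = 0%R.
Proof.
move=> t0 Q0; have bg := @bmf_gauss R n t t0.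
set u := signed_int _ _ _ _ _.
have E c h : signed_int l l' c z h = (signed_int l l' 0%R 0%R h + c * h z)%R.
  by rewrite /signed_int mul0r addr0.
have Q c : signed_int2 l l' c z (gauss t) = (2 * c * u + c ^+ 2)%R.
  rewrite /signed_int2 E; under eq_fun do rewrite E.
  rewrite signed_intD; last 2 first.
  - exact: bmf_signed_int.
  - by apply: bmfM; [exact: bmf_cst|exact: bmf_gaussl].
  rewrite signed_intZ; last exact: bmf_gaussl.
  rewrite [signed_int _ _ _ _ _](_ : _ = 0)%R// add0r.
  have -> : (fun x => gauss t (z, x)) = (fun x => gauss t (x, z)).
    by apply/funext => x; rewrite /gauss/= sqdC.
  rewrite E; have -> : gauss t (z, z) = 1%R.
    have /eqP zz : sqd z z == 0%R by rewrite sqd_eq0.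
    by rewrite /gauss/= zz mulr0 oppr0 expR0.
  by rewrite -/u; ring.
have [_ /(_ (fun=> 1%R) (bmf_cst _ _))] := @psd_gauss R n l l' (- u) z t t0.
under eq_fun do rewrite !mul1r.
rewrite Q (_ : _ + _ = - u ^+ 2)%R; last by ring.
by rewrite oppr_ge0 => uu; apply/eqP; rewrite -sqrf_eq0 eq_le sqr_ge0 andbT.
Qed.

Lemma mutualD_mixture (a b c d : {finite_measure set Rn -> \bar R}) :
  gauss_mix p 1 * (mutual a b + mutual c d) =
  \int[leb]_v (gmutual a b (`|v| `^ p)%R + gmutual c d (`|v| `^ p)%R).
Proof.
rewrite (@ge0_muleDr _ _ (mutual a b) (mutual c d)) ?mutual_ge0//.
rewrite (mutual_mixture a b) (mutual_mixture c d) [RHS]ge0_integralD//.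
- by move=> v _; exact: gmutual_ge0.
- exact: measurable_gmutual.
- by move=> v _; exact: gmutual_ge0.
- exact: measurable_gmutual.
Qed.

(** The inequality 2<l, l'> <= ||l||^2 + ||l'||^2, integrated from the Gaussian
    kernels.  The energies may be infinite, so it is stated with sums only. *)
Lemma mutual_ineq l l' :
  mutual l l' + mutual l' l <= mutual l l + mutual l' l'.
Proof.
(* multiplication by the constant C, positive and finite, turns Riesz energies
   into integrals of Gaussian energies *)
have C0 := @gauss_mix1_gt0 R p p_gt0; have Cfin : gauss_mix p 1 \is a fin_num.
  by rewrite ge0_fin_numE ?gauss_mix_ge0// gauss_mix1_lty.
rewrite -(lee_pmul2l Cfin C0) !mutualD_mixture.
apply: ge0_le_integral.
- exact: measurableT.
- by move=> v _; rewrite adde_ge0 ?gmutual_ge0.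
- by apply: emeasurable_funD; exact: measurable_gmutual.
- by apply: emeasurable_funD; exact: measurable_gmutual.
move=> v _; have t0 : (0 <= `|v| `^ p)%R by exact: powR_ge0.
rewrite !gmutualE// -!EFinD lee_fin -subr_ge0.
by have := @signed_int2_gauss_ge0 l l' _ t0; rewrite signed_int2_gauss.
Qed.

(** The Gaussian energies S(v) of l - l' are nonnegative with integral zero, so
    they vanish for almost all v.  Any interval to the right of t contains a
    parameter |v|^p of such a v, and the Gaussian energy is continuous in t. *)
Lemma energy_eq_signed_int2_eq0 l l' : mutual l l < +oo -> mutual l' l' < +oo ->
  mutual l l + mutual l' l' <= mutual l l' + mutual l' l ->
  forall t : R, (0 < t)%R -> signed_int2 l l' 0%R 0%R (gauss t) = 0%R.
Proof.
move=> fl fl' le t t0.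
have C0 := @gauss_mix1_gt0 R p p_gt0; have Cfin : gauss_mix p 1 \is a fin_num.
  by rewrite ge0_fin_numE ?gauss_mix_ge0// gauss_mix1_lty.
pose S (v : R) := signed_int2 l l' 0%R 0%R (gauss (`|v| `^ p)).
pose X (v : R) := gmutual l l' (`|v| `^ p)%R + gmutual l' l (`|v| `^ p)%R.
have S0 v : (0 <= S v)%R by apply: signed_int2_gauss_ge0; exact: powR_ge0.
have SE v : gmutual l l (`|v| `^ p)%R + gmutual l' l' (`|v| `^ p)%R = X v + (S v)%:E.
  have v0 := powR_ge0 `|v|%R p.
  by rewrite /X /S !gmutualE// signed_int2_gauss// -!EFinD; congr EFin; ring.
have mS : measurable_fun setT S.
  have -> : S = (fun v => fine (gmutual l l (`|v| `^ p)%R) +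
       fine (gmutual l' l' (`|v| `^ p)%R)
     - (fine (gmutual l l' (`|v| `^ p)%R) + fine (gmutual l' l (`|v| `^ p)%R)))%R.
    by apply/funext => v; rewrite /S signed_int2_gauss ?powR_ge0// !gmutualE ?powR_ge0.
  by apply: measurable_funB; apply: measurable_funD;
    apply: (measurableT_comp (@fine_measurable R setT measurableT));
    exact: measurable_gmutual.
have intS : \int[leb]_v (S v)%:E = 0.
  move: le; rewrite -(lee_pmul2l Cfin C0).
  have : gauss_mix p 1 * (mutual l l + mutual l' l') < +oo.
    by apply: lte_mul_pinfty; [exact: ltW|exact: Cfin|exact: lte_add_pinfty].
  rewrite !mutualD_mixture.
  under eq_integral do rewrite SE.
  rewrite ge0_integralD//; last 4 first.
  - by move=> v _; rewrite adde_ge0 ?gmutual_ge0.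
  - by apply: emeasurable_funD; exact: measurable_gmutual.
  - by move=> v _; rewrite lee_fin.
  - exact/measurable_EFinP.
  rewrite -/(X _) => foo XS.
  have X0 : 0 <= \int[leb]_v X v.
    by apply: integral_ge0 => v _; rewrite adde_ge0 ?gmutual_ge0.
  have iS0 : 0 <= \int[leb]_v (S v)%:E by apply: integral_ge0 => v _; rewrite lee_fin.
  have Xfin : \int[leb]_v X v \is a fin_num.
    by rewrite ge0_fin_numE// (le_lt_trans _ foo)// leeDl.
  apply/eqP; rewrite eq_le iS0 andbT.
  by move: XS; rewrite -[leRHS]adde0 leeD2lE.
(* N contains every v with S v <> 0 *)
have [N [mN N0 SN]] : ae_eq leb setT (EFin \o S) (cst 0).
  apply/ae_eq_integral_abs => //; first exact/measurable_EFinP.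
  by rewrite -intS; apply: eq_integral => v _ /=; rewrite ger0_norm.
have tau m : exists r, (t < r < t + m.+1%:R^-1)%R /\ signed_int2 l l' 0%R 0%R (gauss r) = 0%R.
  have tm : (t < t + m.+1%:R^-1)%R by rewrite ltrDl invr_gt0.
  have tm0 : (0 < t + m.+1%:R^-1)%R by rewrite addr_gt0 ?invr_gt0.
  have powK (x : R) : (0 < x)%R -> ((x `^ p^-1) `^ p = x)%R.
    by move=> x0; rewrite -powRrM mulVf ?gt_eqF// powRr1 ?ltW.
  have ab : (t `^ p^-1 < (t + m.+1%:R^-1) `^ p^-1)%R.
    by apply: gt0_ltr_powR; rewrite ?invr_gt0 ?nnegrE ?ltW.
  apply: contrapT => nex.
  have : (0 < leb `](t `^ p^-1)%R, ((t + m.+1%:R^-1) `^ p^-1)%R[%classic).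
    by rewrite lebesgue_measure_itv/= lte_fin ab -EFinB lte_fin subr_gt0.
  apply/negP; rewrite -leNgt -N0; apply: le_measure; rewrite ?inE//.
  move=> v; rewrite /= in_itv/= => /andP[tv vt]; apply: SN => /= Sv; apply: nex.
  have v0 : (0 < v)%R by rewrite (le_lt_trans _ tv)// powR_ge0.
  exists (v `^ p)%R; split.
    rewrite -(powK _ tm0) -{1}(powK t t0).
    by apply/andP; split; apply: gt0_ltr_powR; rewrite ?nnegrE ?powR_ge0// ltW.
  by have := Sv Logic.I; rewrite /S ger0_norm ?ltW// => -[].
have [r rP] := choice tau.
have rt : r m @[m --> \oo] --> t.
  apply: (@squeeze_cvgr _ _ _ _ (cst t) (fun m => t + m.+1%:R^-1)%R).
  - by near=> m; have [/andP[a b] _] := rP m; rewrite !ltW.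
  - exact: cvg_cst.
  - by rewrite -[X in _ --> X]addr0; apply: cvgD; [exact: cvg_cst|exact: cvg_harmonic].
have r0 m : (0 <= r m)%R.
  by have [/andP[a _] _] := rP m; rewrite ltW// (lt_trans t0).
have : signed_int2 l l' 0%R 0%R (gauss (r m)) @[m --> \oo] -->
    signed_int2 l l' 0%R 0%R (gauss t).
  apply: (@signed_int2_cvg _ _ _ _ _ _ _ _ _ 1).
  - by move=> m; exact: measurable_gauss.
  - by move=> m q; exact: normr_gauss_le1.
  - move=> q; have ms : (- (r m * sqd q.1 q.2))%R @[m --> \oo] -->
        (- (t * sqd q.1 q.2))%R.
      by apply: cvgN; apply: cvgMr_tmp.
    exact: (cvg_comp _ _ ms (@continuous_expR R _)).
under eq_fun do rewrite (rP _).2.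
by move=> /cvg_lim <- //; rewrite lim_cst.
Unshelve. all: by end_near. Qed.

(** Strict positive definiteness of the Riesz kernel: the hypothesis says that
    ||l - l'||^2 <= 0. *)
Lemma energy_principle l l' : mutual l l < +oo -> mutual l' l' < +oo ->
  mutual l l + mutual l' l' <= mutual l l' + mutual l' l ->
  forall B, measurable B -> l B = l' B.
Proof.
move=> fl fl' le; apply: gauss_determines => t z t0.
by apply: signed_int_gauss_eq0; [exact: ltW|exact: energy_eq_signed_int2_eq0].
Qed.

End finite.

End riesz_energy.

(** * Locally finite measures *)

Section packing.
Context d (T : measurableType d) (R : realType).
Local Open Scope ereal_scope.

Lemma sigma_finite_measureP (m : {measure set T -> \bar R}) : sigma_finite setT m ->
  exists m' : {sigma_finite_measure set T -> \bar R}, m' = m :> (set T -> \bar R).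
Proof.
move=> sm.
pose H1 := @isSFinite.Build _ _ _ m (sfinite_measure_sigma_finite sm).
pose H2 := @isSigmaFinite.Build _ _ _ m sm.
pose m' := HB.pack_for {sigma_finite_measure set T -> \bar R} (Measure.sort m) H1 H2.
by exists m'.
Qed.

Lemma finite_measureP (m : {measure set T -> \bar R}) : m setT < +oo ->
  exists m' : {finite_measure set T -> \bar R}, m' = m :> (set T -> \bar R).
Proof.
move=> mT; have fm : fin_num_fun m.
  move=> A mA; rewrite ge0_fin_numE// (le_lt_trans _ mT)//.
  by apply: le_measure; rewrite ?inE.
have sm : sigma_finite setT m by apply: fin_num_fun_sigma_finite => //; rewrite measure0.
pose H1 := @isSFinite.Build _ _ _ m (sfinite_measure_sigma_finite sm).
pose H2 := @isSigmaFinite.Build _ _ _ m sm.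
pose H3 := @isFinite.Build _ _ _ m fm.
pose m' := HB.pack_for {finite_measure set T -> \bar R} (Measure.sort m) H1 H2 H3.
by exists m'.
Qed.

Lemma integral_measure0 (m : {measure set T -> \bar R}) f :
  (forall B, measurable B -> m B = 0) -> \int[m]_x f x = 0.
Proof.
move=> m0; rewrite -[RHS](integral_measure_zero setT f).
by apply: eq_measure_integral => B mB _; rewrite m0.
Qed.

End packing.

Section euclidean.
Context (R : realType) (n : nat) (alpha : R).
Local Notation Rn := 'rV[R]_n.
Local Open Scope ereal_scope.

Lemma closed_normr_le (k : R) : closed [set x : Rn | (`|x| <= k)%R].
Proof.
have -> : [set x : Rn | (`|x| <= k)%R] =
    (fun x => `|x|%R) @^-1` [set r | (r <= k)%R] by [].
apply: closed_comp => [x _|]; first exact: norm_continuous.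
exact: closed_le.
Qed.

Lemma compact_normr_le (k : R) : compact [set x : Rn | (`|x| <= k)%R].
Proof.
apply: bounded_closed_compact; last exact: closed_normr_le.
by exists k; split => [|M kM x /= /le_trans]; [exact: num_real|apply; exact: ltW].
Qed.

Lemma measurable_normr_le (k : R) : measurable [set x : Rn | (`|x| <= k)%R].
Proof.
rewrite -[X in measurable X]setCK; apply: measurableC; apply: sub_sigma_algebra.
exact/closed_openC/closed_normr_le.
Qed.

Lemma bigcup_normr_le : \bigcup_k [set x : Rn | (`|x| <= k%:R)%R] = setT.
Proof.
apply/seteqP; split=> // x _; exists (Num.trunc `|x|).+1 => //=.
by have /truncn_itv/andP[_ /ltW] := normr_ge0 x.
Qed.

Lemma nd_normr_le : nondecreasing_seq (fun k : nat => [set x : Rn | (`|x| <= k%:R)%R]).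
Proof.
by move=> i j ij; apply/subsetPset => x /= /le_trans; apply; rewrite ler_nat.
Qed.

Lemma locally_finite_sigma_finite (m : {measure set Rn -> \bar R}) :
  (forall K, compact K -> m K < +oo) -> sigma_finite setT m.
Proof.
move=> mK; exists (fun k => [set x : Rn | (`|x| <= k%:R)%R]).
  by rewrite bigcup_normr_le.
by move=> k; split; [exact: measurable_normr_le|exact/mK/compact_normr_le].
Qed.

Hypothesis alphan : (alpha < n%:R)%R.

Lemma euclid_normC (x y : Rn) : euclid_norm (x - y) = euclid_norm (y - x).
Proof.
rewrite /euclid_norm; congr Num.sqrt; apply: eq_bigr => i _.
by rewrite -sqrrN !mxE opprB.
Qed.

Lemma rieszC (x y : Rn) : riesz alpha x y = riesz alpha y x.
Proof. by rewrite /riesz eq_sym euclid_normC. Qed.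

Lemma mutualC (m m' : {sigma_finite_measure set Rn -> \bar R}) :
  mutual alpha m m' = mutual alpha m' m.
Proof.
rewrite /mutual (fubini_tonelli (m1 := m) (m2 := m')
    (fun q => riesz alpha q.1 q.2)).
- by apply: eq_integral => y _; apply: eq_integral => x _; exact: rieszC.
- exact: measurable_riesz.
- by move=> q; exact: riesz_ge0.
Qed.

Lemma mutual_prod (m m' : {sigma_finite_measure set Rn -> \bar R}) :
  \int[m \x m']_z riesz alpha z.1 z.2 = mutual alpha m m'.
Proof.
rewrite (fubini_tonelli1 (fun q : Rn * Rn => riesz alpha q.1 q.2))//.
- exact: measurable_riesz.
- by move=> q; exact: riesz_ge0.
Qed.

Lemma integral_mfrestr (m : {measure set Rn -> \bar R}) (D : set Rn)
    (mD : measurable D) (moo : m D < +oo) (f : Rn -> \bar R) :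
  measurable_fun setT f -> (forall x, 0 <= f x) ->
  \int[mfrestr mD moo]_x f x = \int[m]_(x in D) f x.
Proof.
move=> mf f0; rewrite (ge0_negligible_integral (N := ~` D))//; last 2 first.
- exact: measurableC.
- by rewrite -[LHS]/(m (~` D `&` D)) setICl measure0.
rewrite setTD setCK; apply: eq_measure_integral => B mB BD.
by rewrite -[LHS]/(m (B `&` D)) setIidl.
Qed.

(** By [mutual_ineq] the mutual energies of l and the restrictions of m to balls,
    which are finite measures, are bounded by ||m||^2 + ||l||^2; the restrictions
    increase to m. *)
Lemma mutual_lty (m : {measure set Rn -> \bar R})
    (l : {finite_measure set Rn -> \bar R}) :
  (forall K, compact K -> m K < +oo) ->
  mutual alpha m m < +oo -> mutual alpha l l < +oo -> mutual alpha l m < +oo.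
Proof.
move=> mK mm ll.
have [m' m'E] := sigma_finite_measureP (locally_finite_sigma_finite mK).
rewrite -m'E mutualC m'E.
pose F k := [set x : Rn | (`|x| <= k%:R)%R].
have mF k : measurable (F k) by exact: measurable_normr_le.
have Foo k : m (F k) < +oo by exact/mK/compact_normr_le.
pose U x := \int[l]_y riesz alpha x y.
have mU : measurable_fun setT U by exact: measurable_potential.
have U0 x : 0 <= U x by apply: integral_ge0 => y _; exact: riesz_ge0.
have : \int[m]_(x in F k) U x @[k --> \oo] --> \int[m]_x U x.
  rewrite -[X in _ --> \int[m]_(x in X) _]bigcup_normr_le.
  apply: ge0_nondecreasing_set_cvg_integral => //; first exact: nd_normr_le.
  by move=> k; exact: measurable_funTS.
rewrite -/(mutual alpha m l) => Ucvg.
suff bnd k : \int[m]_(x in F k) U x <= mutual alpha m m + mutual alpha l l.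
  apply: (@le_lt_trans _ _ (mutual alpha m m + mutual alpha l l)).
    rewrite -(cvg_lim _ Ucvg)//; apply: lime_le; last exact: nearW.
    by apply/cvg_ex; eexists; exact: Ucvg.
  exact: lte_add_pinfty.
rewrite -(integral_mfrestr (mF k) (Foo k))// -/(mutual alpha (mfrestr (mF k) (Foo k)) l).
have := mutual_ineq alphan (mfrestr (mF k) (Foo k)) l.
move=> H; apply: (le_trans (le_trans _ H)); first by rewrite leeDl// mutual_ge0.
rewrite leeD2r// /mutual.
rewrite integral_mfrestr//; last 2 first.
- exact: measurable_potential.
- by move=> x; apply: integral_ge0 => y _; exact: riesz_ge0.
have mV : measurable_fun setT (fun x => \int[m]_y riesz alpha x y).
  by rewrite -m'E; exact: measurable_potential.
have mr x : measurable_fun setT (fun y : Rn => riesz alpha x y).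
  exact: (measurableT_comp (measurable_riesz alpha) (pair1_measurable x)).
apply: (@le_trans _ _ (\int[m]_(x in F k) \int[m]_y riesz alpha x y)).
  apply: ge0_le_integral => //.
  - by move=> x _; apply: integral_ge0 => y _; exact: riesz_ge0.
  - by apply: measurable_funTS; exact: measurable_potential.
  - exact: measurable_funTS.
  move=> x _; rewrite integral_mfrestr//.
  - apply: ge0_subset_integral => //.
    by move=> y _; exact: riesz_ge0.
  - by move=> y; exact: riesz_ge0.
apply: ge0_subset_integral => //.
by move=> x _; apply: integral_ge0 => y _; exact: riesz_ge0.
Qed.

End euclidean.

(** * Positive measures among the signed measures *)

Section positive_signed_measures.
Context (R : realType) (n : nat) (alpha : R).
Hypothesis alphan : (alpha < n%:R)%R.
Local Notation Rn := 'rV[R]_n.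
Local Notation smeasure := (signed_measure n alpha).
Local Open Scope ereal_scope.
Implicit Types mu nu : smeasure.

Lemma sigma_finite_pos mu : exists m : {sigma_finite_measure set Rn -> \bar R},
  m = sm_pos mu :> (set Rn -> \bar R).
Proof. exact/sigma_finite_measureP/locally_finite_sigma_finite/sm_posK. Qed.

Lemma sigma_finite_neg mu : exists m : {sigma_finite_measure set Rn -> \bar R},
  m = sm_neg mu :> (set Rn -> \bar R).
Proof. exact/sigma_finite_measureP/locally_finite_sigma_finite/sm_negK. Qed.

Lemma measurable_potential_pos mu :
  measurable_fun setT (fun x => \int[sm_pos mu]_y riesz alpha x y).
Proof. by have [p <-] := sigma_finite_pos mu; exact: measurable_potential. Qed.

Lemma measurable_potential_neg mu :
  measurable_fun setT (fun x => \int[sm_neg mu]_y riesz alpha x y).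
Proof. by have [p <-] := sigma_finite_neg mu; exact: measurable_potential. Qed.

(** Tonelli's theorem on each of the four products. *)
Lemma energyE mu : energy mu =
  (mutual alpha (sm_pos mu) (sm_pos mu) + mutual alpha (sm_neg mu) (sm_neg mu)) -
  (mutual alpha (sm_pos mu) (sm_neg mu) + mutual alpha (sm_neg mu) (sm_pos mu)).
Proof.
rewrite /energy /inner_product.
have [p <-] := sigma_finite_pos mu; have [m <-] := sigma_finite_neg mu.
by rewrite (mutual_prod alpha p p) (mutual_prod alpha m m) (mutual_prod alpha p m)
  (mutual_prod alpha m p).
Qed.

Lemma finite_energy_lty mu : finite_energy mu ->
  mutual alpha (sm_pos mu) (sm_pos mu) < +oo /\
  mutual alpha (sm_neg mu) (sm_neg mu) < +oo.
Proof.
rewrite /finite_energy/= energyE fin_numB fin_numD => /andP[/andP[+ +] _].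
by rewrite !ge0_fin_numE ?mutual_ge0.
Qed.

Section positive.
Variables (mu : smeasure) (mu0 : sm_positive mu).

Lemma energy_positive : energy mu = mutual alpha (sm_pos mu) (sm_pos mu).
Proof.
have z1 (m : {measure set Rn -> \bar R}) : mutual alpha (sm_neg mu) m = 0.
  by rewrite /mutual integral_measure0.
have z2 : mutual alpha (sm_pos mu) (sm_neg mu) = 0.
  rewrite /mutual; under eq_integral do rewrite (integral_measure0 _ mu0).
  exact: integral0.
by rewrite energyE !z1 z2 !adde0 sube0.
Qed.

Lemma finite_energy_positive :
  finite_energy mu <-> mutual alpha (sm_pos mu) (sm_pos mu) < +oo.
Proof. by rewrite /finite_energy/= energy_positive ge0_fin_numE// mutual_ge0. Qed.

Lemma sm_integral_positive g : sm_integral mu g = \int[sm_pos mu]_x g x.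
Proof. by rewrite /sm_integral (integral_measure0 _ mu0) sube0. Qed.

Lemma I_f_positive f :
  I_f f mu = mutual alpha (sm_pos mu) (sm_pos mu) + 2%:E * \int[sm_pos mu]_x f x.
Proof.
by rewrite /I_f /energy_norm sm_integral_positive sqr_sqrte energy_positive// mutual_ge0.
Qed.

Lemma mass_positive : mass mu = sm_pos mu setT.
Proof. by rewrite /mass mu0// sube0. Qed.

Lemma sm_abs_positive B : measurable B -> sm_abs mu B = sm_pos mu B.
Proof.
move=> mB; have -> : sm_abs mu B = sm_pos mu B + sm_neg mu B by exact: measure_addE.
by rewrite mu0// adde0.
Qed.

Lemma integrable_positive (f : Rn -> \bar R) :
  (sm_abs mu).-integrable setT f <-> (sm_pos mu).-integrable setT f.
Proof.
have E : \int[sm_abs mu]_x `|f x| = \int[sm_pos mu]_x `|f x|.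
  by apply: eq_measure_integral => B mB _; exact: sm_abs_positive.
by split=> /integrableP[mf fi]; apply/integrableP; split=> //; move: fi; rewrite E.
Qed.

Lemma negligible_positive (B : set Rn) :
  (sm_abs mu).-negligible B <-> (sm_pos mu).-negligible B.
Proof.
by split=> -[N [mN N0 BN]]; exists N; split=> //; move: N0; rewrite sm_abs_positive.
Qed.

End positive.

(** The negative part is zero; what is left to check is that a mu + b nu inherits
    local finiteness and the growth condition at infinity. *)
Lemma combination (a b : {nonneg R}) mu nu : sm_positive mu -> sm_positive nu ->
  exists sigma : smeasure, sm_positive sigma /\
    sm_pos sigma = measure_add (mscale a (sm_pos mu)) (mscale b (sm_pos nu))
      :> (set Rn -> \bar R).
Proof.
move=> mu0 nu0.
pose M : {measure set Rn -> \bar R} :=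
  measure_add (mscale a (sm_pos mu)) (mscale b (sm_pos nu)).
pose Z : {measure set Rn -> \bar R} := mzero.
have ME B : M B = a%:num%:E * sm_pos mu B + b%:num%:E * sm_pos nu B.
  exact: measure_addE.
have MK K : compact K -> M K < +oo.
  move=> cK; rewrite ME lte_add_pinfty// lte_mul_pinfty ?lee_fin//; exact: sm_posK.
have ZK K : compact K -> Z K < +oo by move=> _; exact: ltry.
have MZ : exists P : set Rn, [/\ measurable P, M (~` P) = 0 & Z P = 0].
  by exists setT; split=> //; rewrite setCT measure0.
pose D := [set y : Rn | (1 < euclid_norm y)%R].
have mN : measurable_fun setT (@euclid_norm R n).
  have -> : @euclid_norm R n = (fun x => sqd x 0 `^ 2^-1)%R.
    apply/funext => x; rewrite powR12_sqrt ?sqd_ge0// /euclid_norm; congr Num.sqrt.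
    by apply: eq_bigr => i _; rewrite mxE subr0.
  apply: (measurableT_comp (measurable_powR _)); exact: measurable_sqdl.
have mD : measurable D.
  by rewrite -[X in measurable X]setTI; apply: measurable_fun_ltr.
pose k (y : Rn) := (euclid_norm y `^ (alpha - n%:R))%:E.
have mk : measurable_fun D k.
  apply: measurable_funTS; apply/measurable_EFinP.
  exact: (measurableT_comp (measurable_powR _) mN).
have k0 y : 0 <= k y by rewrite lee_fin powR_ge0.
have tailP mu' : \int[sm_pos mu']_(y in D) k y < +oo.
  apply: le_lt_trans (sm_tail mu'); rewrite ge0_integral_measure_add//; last first.
    by move=> y _; exact: k0.
  by rewrite leeDl//; apply: integral_ge0 => y _; exact: k0.
have MT : \int[measure_add M Z]_(y in D) k y < +oo.
  rewrite ge0_integral_measure_add// integral_measure_zero adde0.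
  rewrite ge0_integral_measure_add// !ge0_integral_mscale//.
  by apply: lte_add_pinfty; apply: lte_mul_pinfty => //; exact: tailP.
by exists (@SignedMeasure R n alpha M Z MK ZK MZ MT); split.
Qed.

Section combination_integrals.
Variables (a b : {nonneg R}) (m m' : {measure set Rn -> \bar R}).
Let M : {measure set Rn -> \bar R} := measure_add (mscale a m) (mscale b m').

Lemma ge0_integral_combination f : measurable_fun setT f -> (forall x, 0 <= f x) ->
  \int[M]_x f x = a%:num%:E * \int[m]_x f x + b%:num%:E * \int[m']_x f x.
Proof. by move=> mf f0; rewrite ge0_integral_measure_add// !ge0_integral_mscale. Qed.

Lemma integrable_combination f : m.-integrable setT f -> m'.-integrable setT f ->
  M.-integrable setT f.
Proof.
move=> /integrableP[mf fm] /integrableP[_ fm']; apply/integrableP; split=> //.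
rewrite ge0_integral_combination//; last exact: measurableT_comp.
by rewrite lte_add_pinfty// lte_mul_pinfty ?lee_fin.
Qed.

Lemma integral_combination f : m.-integrable setT f -> m'.-integrable setT f ->
  \int[M]_x f x = a%:num%:E * \int[m]_x f x + b%:num%:E * \int[m']_x f x.
Proof.
move=> im im'; have mf := measurable_int _ im.
rewrite (integralE M) (integralE m) (integralE m').
rewrite !ge0_integral_combination//; try exact: measurable_funepos;
  try exact: measurable_funeneg.
have pfin (k : {measure set Rn -> \bar R}) (ik : k.-integrable setT f) :=
  integrable_pos_fin_num measurableT ik.
have nfin (k : {measure set Rn -> \bar R}) (ik : k.-integrable setT f) :=
  integrable_neg_fin_num measurableT ik.
rewrite -(fineK (pfin _ im)) -(fineK (nfin _ im)).
rewrite -(fineK (pfin _ im')) -(fineK (nfin _ im')).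
by rewrite -!EFinB -!EFinM -!EFinD; congr EFin; ring.
Qed.

End combination_integrals.

Lemma mutual_combination (a b : {nonneg R}) (m m' : {measure set Rn -> \bar R}) :
  measurable_fun setT (fun x => \int[m]_y riesz alpha x y) ->
  measurable_fun setT (fun x => \int[m']_y riesz alpha x y) ->
  let M := measure_add (mscale a m) (mscale b m') in
  mutual alpha M M =
    a%:num%:E * (a%:num%:E * mutual alpha m m + b%:num%:E * mutual alpha m m') +
    b%:num%:E * (a%:num%:E * mutual alpha m' m + b%:num%:E * mutual alpha m' m').
Proof.
move=> mU mU' M; have mr x : measurable_fun setT (fun y : Rn => riesz alpha x y).
  exact: (measurableT_comp (measurable_riesz alpha) (pair1_measurable x)).
have U0 (k : {measure set Rn -> \bar R}) x : 0 <= \int[k]_y riesz alpha x y.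
  by apply: integral_ge0 => y _; exact: riesz_ge0.
have inner (k : {measure set Rn -> \bar R}) : mutual alpha k M =
    a%:num%:E * mutual alpha k m + b%:num%:E * mutual alpha k m'.
  rewrite /mutual; under eq_integral => x _.
    rewrite ge0_integral_combination//; last by move=> y; exact: riesz_ge0.
    over.
  rewrite ge0_integralD//; last 4 first.
  - by move=> x _; apply: mule_ge0; [rewrite lee_fin|exact: U0].
  - by apply: measurable_funeM.
  - by move=> x _; apply: mule_ge0; [rewrite lee_fin|exact: U0].
  - by apply: measurable_funeM.
  by rewrite !ge0_integralZl_EFin//; move=> x _; exact: U0.
have mV : measurable_fun setT (fun x => \int[M]_y riesz alpha x y).
  under eq_fun => x do
    (rewrite ge0_integral_combination//; last by move=> y; exact: riesz_ge0).
  by apply: emeasurable_funD; apply: measurable_funeM.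
rewrite -(inner m) -(inner m') {1}/mutual ge0_integral_combination//.
by move=> x; exact: U0.
Qed.

End positive_signed_measures.

(** * Energies in an external field *)

Section external_field.
Context (R : realType) (n : nat) (alpha : R) (A : set 'rV[R]_n).
Hypothesis alphan : (alpha < n%:R)%R.
Local Notation Rn := 'rV[R]_n.
Local Notation smeasure := (signed_measure n alpha).
Local Open Scope ereal_scope.
Implicit Types mu nu omega : smeasure.

Lemma measurable_external_field omega : measurable_fun setT (external_field omega).
Proof.
apply: measurableT_comp => //; apply: emeasurable_funB.
  exact: measurable_potential_pos.
exact: measurable_potential_neg.
Qed.

Lemma abse_external_field_le omega x : `|external_field omega x| <=
  \int[sm_pos omega]_y riesz alpha x y + \int[sm_neg omega]_y riesz alpha x y.
Proof.
have U0 (m : {measure set Rn -> \bar R}) : 0 <= \int[m]_y riesz alpha x y.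
  by apply: integral_ge0 => y _; exact: riesz_ge0.
rewrite /external_field abseN /potential /sm_integral.
by rewrite (le_trans (lee_abs_sub _ _))// !gee0_abs.
Qed.

Lemma unit_mass_finite_measureP mu : sm_positive mu -> mass mu = 1 ->
  exists l : {finite_measure set Rn -> \bar R}, l = sm_pos mu :> (set Rn -> \bar R).
Proof.
move=> mu0; rewrite mass_positive// => mu1.
by apply: finite_measureP; rewrite mu1 ltry.
Qed.

(** Both <mu, omega+> and <mu, omega-> are finite by [mutual_lty]. *)
Lemma integrable_external_field_energy omega mu : finite_energy omega ->
  Eplus alpha A mu -> mass mu = 1 ->
  (sm_pos mu).-integrable setT (external_field omega).
Proof.
move=> /(finite_energy_lty)[op on] [fmu mu0 _] mu1.
have [l lE] := unit_mass_finite_measureP mu0 mu1.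
have ll : mutual alpha l l < +oo by rewrite lE; exact/finite_energy_positive.
apply/integrableP; split; first exact: measurable_external_field.
apply: (@le_lt_trans _ _ (mutual alpha l (sm_pos omega) + mutual alpha l (sm_neg omega))).
  rewrite lE /mutual -ge0_integralD//; last 4 first.
  - by move=> x _; apply: integral_ge0 => y _; exact: riesz_ge0.
  - exact: measurable_potential_pos.
  - by move=> x _; apply: integral_ge0 => y _; exact: riesz_ge0.
  - exact: measurable_potential_neg.
  apply: ge0_le_integral => //.
  - by apply: measurableT_comp => //; exact: measurable_external_field.
  - apply: emeasurable_funD; first exact: measurable_potential_pos.
    exact: measurable_potential_neg.
  - by move=> x _; exact: abse_external_field_le.
apply: lte_add_pinfty; apply: mutual_lty => //; first exact: sm_posK.
exact: sm_negK.
Qed.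

(** The field is bounded by the supremum on A, which carries the finite
    measure mu. *)
Lemma integrable_external_field_bounded omega mu :
  ereal_sup [set \int[sm_abs omega]_y riesz alpha x y | x in A] < +oo ->
  Eplus alpha A mu -> mass mu = 1 ->
  (sm_pos mu).-integrable setT (external_field omega).
Proof.
move=> oA [_ mu0 muA]; rewrite mass_positive// => mu1.
apply/integrableP; split; first exact: measurable_external_field.
pose M := maxe (ereal_sup [set \int[sm_abs omega]_y riesz alpha x y | x in A]) 0.
have M0 : 0 <= M by rewrite le_max lexx orbT.
have Moo : M < +oo by rewrite gt_max oA ltry.
apply: (@le_lt_trans _ _ (M * sm_pos mu setT)); last by rewrite mu1 mule1.
apply: integral_le_bound => //; first exact: measurable_external_field.
have [N [mN N0 AN]] := (negligible_positive mu0 _).1 muA.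
exists N; split=> // x; apply: contra_notP => xN _ /=.
have Ax : A x by apply: contrapT => nA; exact/xN/AN.
apply: (le_trans (abse_external_field_le _ _)).
rewrite -ge0_integral_measure_add//; last 2 first.
- by move=> y _; exact: riesz_ge0.
- exact: (measurableT_comp (measurable_riesz alpha) (pair1_measurable x)).
by rewrite le_max; apply/orP; left; apply: ereal_sup_ubound; exists x.
Qed.

Variable f : Rn -> \bar R.

Definition fine_mutual mu nu : R := fine (mutual alpha (sm_pos mu) (sm_pos nu)).
Definition fine_field mu : R := fine (\int[sm_pos mu]_y f y).

Lemma unit_mutual_lty mu nu : sm_positive mu -> sm_positive nu ->
  finite_energy mu -> finite_energy nu -> mass mu = 1 -> mass nu = 1 ->
  mutual alpha (sm_pos mu) (sm_pos nu) < +oo.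
Proof.
move=> mu0 nu0 /finite_energy_positive emu /finite_energy_positive enu mu1 nu1.
have [l lE] := unit_mass_finite_measureP mu0 mu1.
rewrite -lE; apply: mutual_lty; first exact: alphan; first exact: sm_posK.
- exact: enu.
- by rewrite lE; exact: emu.
Qed.

Lemma energy_principle_positive mu nu : sm_positive mu -> sm_positive nu ->
  finite_energy mu -> finite_energy nu -> mass mu = 1 -> mass nu = 1 ->
  (fine_mutual mu mu + fine_mutual nu nu <= fine_mutual mu nu + fine_mutual nu mu)%R ->
  sm_eq mu nu.
Proof.
move=> mu0 nu0 fmu fnu mu1 nu1 le B mB; split; last by rewrite mu0// nu0.
have [l lE] := unit_mass_finite_measureP mu0 mu1.
have [l' l'E] := unit_mass_finite_measureP nu0 nu1.
rewrite -lE -l'E; apply: (energy_principle alphan) => //.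
- by rewrite lE; exact: unit_mutual_lty.
- by rewrite l'E; exact: unit_mutual_lty.
rewrite lE l'E; move: le; rewrite -lee_fin !EFinD /fine_mutual.
by rewrite !fineK// ge0_fin_numE ?mutual_ge0//; exact: unit_mutual_lty.
Qed.

Lemma I_f_fine mu : Eplus_f f A mu -> I_f f mu = (fine_mutual mu mu + 2 * fine_field mu)%:E.
Proof.
move=> [[fmu mu0 _] /(integrable_positive mu0) imu].
rewrite I_f_positive// [in RHS]EFinD [in RHS]EFinM !fineK//.
  exact: integrable_fin_num.
by rewrite ge0_fin_numE ?mutual_ge0//; exact/finite_energy_positive.
Qed.

(** Used with (s, 0), for the multiples of a measure, and with (1/2, 1/2), for
    the midpoint of two measures. *)
Lemma combination_Eplus_f (a b : {nonneg R}) mu nu :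
  Eplus_f f A mu -> Eplus_f f A nu -> mass mu = 1 -> mass nu = 1 ->
  exists sigma : smeasure, [/\ Eplus_f f A sigma,
    mass sigma = (a%:num + b%:num)%:E &
    I_f f sigma = (a%:num * (a%:num * fine_mutual mu mu + b%:num * fine_mutual mu nu) +
      b%:num * (a%:num * fine_mutual nu mu + b%:num * fine_mutual nu nu) +
      2 * (a%:num * fine_field mu + b%:num * fine_field nu))%:E].
Proof.
move=> [[fmu mu0 muA] /(integrable_positive mu0) imu].
move=> [[fnu nu0 nuA] /(integrable_positive nu0) inu].
move=> mu1 nu1.
have [sigma [sigma0 sE]] := combination a b mu0 nu0.
have emu := (finite_energy_positive mu0).1 fmu.
have enu := (finite_energy_positive nu0).1 fnu.
have [xmn xnm] : mutual alpha (sm_pos mu) (sm_pos nu) < +oo /\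
    mutual alpha (sm_pos nu) (sm_pos mu) < +oo.
  by split; exact: unit_mutual_lty.
have mutE : mutual alpha (sm_pos sigma) (sm_pos sigma) =
    (a%:num * (a%:num * fine_mutual mu mu + b%:num * fine_mutual mu nu) +
      b%:num * (a%:num * fine_mutual nu mu + b%:num * fine_mutual nu nu))%:E.
  rewrite sE mutual_combination; [|exact: measurable_potential_pos..].
  by rewrite !(EFinD, EFinM) /fine_mutual !fineK// ge0_fin_numE// mutual_ge0.
have isigma : (sm_pos sigma).-integrable setT f.
  have := integrable_combination a b imu inu.
  by move=> /integrableP[mf fi]; apply/integrableP; split=> //; rewrite sE.
have [N [mN N0 AN]] := (negligible_positive mu0 _).1 muA.
have [N' [mN' N'0 AN']] := (negligible_positive nu0 _).1 nuA.
have mE B : sm_pos sigma B = a%:num%:E * sm_pos mu B + b%:num%:E * sm_pos nu B.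
  by rewrite sE; exact: measure_addE.
have fsigma : finite_energy sigma.
  by apply/finite_energy_positive => //; rewrite mutE ltry.
have ES : Eplus_f f A sigma.
  split; last exact/integrable_positive.
  split=> //; apply/negligible_positive => //; exists (N `&` N'); split.
  - exact: measurableI.
  - rewrite mE (subset_measure0 _ _ (@subIsetl _ N N'))//; last exact: measurableI.
    rewrite (subset_measure0 _ _ (@subIsetr _ N N'))//; last exact: measurableI.
    by rewrite !mule0 adde0.
  - by move=> y Ay; split; [exact: AN|exact: AN'].
exists sigma; split => //.
  by move: mu1 nu1; rewrite !mass_positive// mE => -> ->; rewrite !mule1.
rewrite I_f_positive// mutE [in RHS]EFinD; congr (_ + _).
rewrite EFinM; congr (_ * _); rewrite sE (integral_combination a b imu inu).
by rewrite EFinD !EFinM /fine_field !fineK//; exact: integrable_fin_num.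
Qed.

End external_field.

(** * Minimizers *)

Local Open Scope ereal_scope.

(** The derivative at s = 1 of s^2 I + 2sL is 2(I + L). *)
Lemma critical_at_one (R : realType) (I L : R) : (0 <= I)%R ->
  (forall s : R, 0 <= s -> I + 2 * L <= s ^+ 2 * I + 2 * s * L)%R -> (I + L = 0)%R.
Proof.
move=> I0 min1; pose q := (I + L)%R; pose D := (I + `|q| + 1)%R.
have D0 : (0 < D)%R by rewrite ltr_wpDl// addr_ge0.
apply: contrapT => /eqP q0; have qq : (0 < q ^+ 2)%R by rewrite exprn_even_gt0.
have : (0 <= 1 - q / D)%R.
  rewrite subr_ge0 ler_pdivrMr// mul1r (le_trans (ler_norm q))// /D.
  by rewrite -addrA addrCA lerDl addr_ge0.
move=> /min1; apply/negP; rewrite -ltNge -subr_gt0.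
have -> : (I + 2 * L - ((1 - q / D) ^+ 2 * I + 2 * (1 - q / D) * L) =
    q ^+ 2 / D ^+ 2 * (D + D - I))%R by rewrite /q; field; rewrite gt_eqF.
rewrite mulr_gt0// ?divr_gt0// ?exprn_gt0//.
by rewrite -addrA ltr_pwDl// subr_ge0 /D -addrA lerDl addr_ge0.
Qed.

Theorem theorem6p3 (R : realType) (n : nat) (alpha : R) (A : set 'rV[R]_n)
    (omega omega_hat : signed_measure n alpha) :
  (2 <= n)%N -> (0 < alpha)%R -> (alpha < n%:R)%R ->
  0 < inner_capacity alpha A ->
  strongly_closed (Eplus alpha A) ->
  (finite_energy omega \/
   [/\ sm_pos omega setT < +oo,
       usc_on (closure A) (potential omega) &
       ereal_sup [set \int[sm_abs omega]_y riesz alpha x y | x in A]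
         < +oo]) ->
  is_inner_pseudo_balayage omega A omega_hat ->
  mass omega_hat = 1 ->
  let f := external_field omega in
  exists lambda : signed_measure n alpha,
    [/\ is_minimizer f A lambda,
        (forall lambda', is_minimizer f A lambda' -> sm_eq lambda' lambda),
        sm_eq lambda omega_hat,
        w_f alpha f A = w_hat_f alpha f A &
        equilibrium_constant f lambda = 0].
Proof.
move=> _ _ alphan _ _ omegaP [Ehat Ihat] mass1 f.
have Eplus1_Eplus_f mu : Eplus1 alpha A mu -> Eplus_f f A mu.
  move=> [Emu mu1]; split=> //; have [_ mu0 _] := Emu.
  apply/integrable_positive => //; case: omegaP => [fo|[_ _ oA]].
    exact: (integrable_external_field_energy alphan fo Emu).
  exact: (integrable_external_field_bounded oA Emu).
have w_hat_le (mu : signed_measure n alpha) :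
    Eplus_f f A mu -> w_hat_f alpha f A <= I_f f mu.
  by move=> Emu; apply: ereal_inf_lbound; exists mu.
have [[fh h0 _] ih] := Ehat.
have E1 : Eplus1 alpha A omega_hat by split=> //; case: Ehat.
have wE : w_f alpha f A = w_hat_f alpha f A.
  apply/eqP; rewrite eq_le; apply/andP; split.
    by rewrite -Ihat; apply: ereal_inf_lbound; exists omega_hat.
  by apply/ereal_infP => _ [mu /Eplus1_Eplus_f Emu <-]; exact: w_hat_le.
have hmin : is_minimizer f A omega_hat by split=> //; rewrite wE.
exists omega_hat; split => //.
- move=> mu [E1mu Imu]; have Emu := Eplus1_Eplus_f _ E1mu.
  have [[fmu mu0 _] mu1] := E1mu.
  apply: (energy_principle_positive alphan) => //.
  have half_ge0 : (0 <= 2^-1 :> R)%R by rewrite invr_ge0.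
  pose half : {nonneg R} := NngNum half_ge0.
  (* the midpoint competes in the cone, where omega_hat is minimal *)
  have [sigma [Esigma _ Isigma]] :=
    combination_Eplus_f alphan half half Emu Ehat mu1 mass1.
  have := w_hat_le _ Esigma; rewrite -Ihat (I_f_fine Ehat) Isigma/= lee_fin => le.
  have := Imu; rewrite wE -Ihat (I_f_fine Ehat) (I_f_fine Emu) => -[eq].
  by move: eq le; lra.
- have scale (s : R) : (0 <= s)%R ->
    (fine_mutual omega_hat omega_hat + 2 * fine_field f omega_hat <=
     s ^+ 2 * fine_mutual omega_hat omega_hat + 2 * s * fine_field f omega_hat)%R.
    move=> s0; have [sigma [Esigma _ Isigma]] :=
      combination_Eplus_f alphan (NngNum s0) (NngNum (lexx 0%R)) Ehat Ehat mass1 mass1.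
    have := w_hat_le _ Esigma; rewrite -Ihat Isigma (I_f_fine Ehat) lee_fin /=.
    by rewrite !mul0r !addr0 expr2 -!mulrA.
  have IL : (fine_mutual omega_hat omega_hat + fine_field f omega_hat = 0)%R.
    have I0 : (0 <= fine_mutual omega_hat omega_hat)%R by rewrite fine_ge0// mutual_ge0.
    exact: critical_at_one scale.
  rewrite /equilibrium_constant sm_integral_positive//.
  have ifh := (integrable_positive h0 f).1 ih.
  have emu := (finite_energy_positive h0).1 fh.
  have U0 x : 0 <= \int[sm_pos omega_hat]_y riesz alpha x y.
    by apply: integral_ge0 => y _; exact: riesz_ge0.
  under eq_integral do rewrite /potential sm_integral_positive//.
  have iU : (sm_pos omega_hat).-integrable setT
      (fun x => \int[sm_pos omega_hat]_y riesz alpha x y).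
    apply/integrableP; split; first exact: measurable_potential_pos.
    by under eq_integral do rewrite gee0_abs//.
  rewrite integralD//.
  have efin : mutual alpha (sm_pos omega_hat) (sm_pos omega_hat) \is a fin_num.
    by rewrite ge0_fin_numE// mutual_ge0.
  have Lfin : \int[sm_pos omega_hat]_x f x \is a fin_num.
    exact: (integrable_fin_num measurableT ifh).
  rewrite -/(mutual alpha (sm_pos omega_hat) (sm_pos omega_hat)).
  by rewrite -(fineK efin) -(fineK Lfin) -EFinD; congr EFin.
Qed.
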